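(* Let $f:\mathbb{B}\to\mathbb{H}$ be a slice regular function such that $\hat d_3(f(\mathbb{B}))=d_3(\mathbb{B})$. Then $$\hat d_3(f(r\mathbb{B}))\le d_3(r\mathbb{B})\quad\text{for every } r\in(0,1) \qquad (A)$$ and $$|\partial_c f(0)|\le1. \qquad (B)$$ Moreover, equality holds in (A) for some $r\in(0,1)$, or in (B), if and only if $f$ is an affine function, $f(q)=a+qb$ with $a,b\in\mathbb{H}$ and $|b|=1$.
   Context: $\mathbb{H}$ denotes the skew field of quaternions with its usual modulus, $\mathbb{B}=\{q\in\mathbb{H}:|q|<1\}$, $r\mathbb{B}=\{q\in\mathbb{H}:|q|<r\}$, $\mathbb{S}=\{q\in\mathbb{H}:q^2=-1\}$, and for $I\in\mathbb{S}$, $L_I=\mathbb{R}+\mathbb{R}I$, $\mathbb{B}_I=\mathbb{B}\cap L_I$; $\overline{\mathbb{B}}_I$ and $r\overline{\mathbb{B}}_I$ are the closed discs of $L_I$ centered at $0$ of radius $1$ and $r$. A function $f:\mathbb{B}\to\mathbb{H}$ is slice regular if for every $I\in\mathbb{S}$ its restriction $f_I$ to $\mathbb{B}_I$ has continuous partial derivatives and satisfies $\frac12\big(\frac{\partial}{\partial x}+I\frac{\partial}{\partial y}\big)f_I(x+yI)=0$ on $\mathbb{B}_I$. Equivalently, $f(q)=\sum_{n\ge0}q^na_n$ with $a_n\in\mathbb{H}$, converging absolutely and uniformly on compact subsets of $\mathbb{B}$. The slice derivative is $\partial_c f(x+yI)=\frac{\partial}{\partial x}f(x+yI)$; in particular $\partial_c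 f(0)=a_1$. For $E\subset\mathbb{H}$ the $3$-diameter is $d_3(E)=\sup_{w_1,w_2,w_3\in E}\big(|w_2-w_1||w_3-w_1||w_3-w_2|\big)^{1/3}$. Slice $3$-diameter: let $f(q)=\sum_{n\ge0}q^na_n$ be slice regular on $\mathbb{B}$. If $a_N$ is the first non-vanishing coefficient, put $b_n=a_na_N^{-1}|a_N|$ for all $n\ge0$ (if $f\equiv0$, put $b_n=0$ for all $n$). For $I\in\mathbb{S}$, $w_1,w_2,w_3\in\overline{\mathbb{B}}_I$ and $z\in\mathbb{B}_I$ put $$\hat g_{w_1,w_2,w_3}(z)=\sum_{n\ge0}z^n\sum_{k=0}^n\sum_{j=0}^k\big(w_2^j-w_1^j\big)\big(w_3^{k-j}-w_1^{k-j}\big)\big(w_3^{n-k}-w_2^{n-k}\big)b_jb_{k-j}b_{n-k}.$$ For $r\in(0,1)$, $$\hat d_3(f(r\mathbb{B}))=\sup_{I\in\mathbb{S}}\ \max_{w_1,w_2,w_3\in\overline{\mathbb{B}}_I}\ \max_{z\in r\overline{\mathbb{B}}_I}\big|\hat g_{w_1,w_2,w_3}(z)\big|^{1/3},$$ and $\hat d_3(f(\mathbb{B}))=\lim_{r\to1^-}\hat d_3(f(r\mathbb{B}))$ (the limit of a non-decreasing function of $r$, possibly $+\infty$). *)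

(* Defs.v *)
From HB Require Import structures.
From mathcomp Require Import all_boot all_order all_algebra.
From mathcomp Require Import all_classical all_reals all_analysis.
From mathcomp Require Import ring lra.

Set Implicit Arguments.
Unset Strict Implicit.
Unset Printing Implicit Defensive.

Import Order.TTheory GRing.Theory Num.Theory.
Import numFieldNormedType.Exports.
Local Open Scope classical_set_scope.
Local Open Scope ring_scope.

(** * The quaternions

    [Quat a b c d] is a + b i + c j + d k. The type [quat R] is equipped with
    its structures of skew field ([unitRingType] in which every nonzero element
    is a unit), of R-algebra, and of normed module over R for the modulus
    `|q| = sqrt (a^2 + b^2 + c^2 + d^2). *)

Record quat (R : Type) := Quat { qre : R; qim_i : R; qim_j : R; qim_k : R }.

Section QuatChoice.
Variable R : choiceType.

Definition tuple_of_quat (q : quat R) := (qre q, qim_i q, qim_j q, qim_k q).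
Definition quat_of_tuple (t : R * R * R * R) :=
  let: (a, b, c, d) := t in Quat a b c d.

Lemma tuple_of_quatK : cancel tuple_of_quat quat_of_tuple.
Proof. by case. Qed.

HB.instance Definition _ := Choice.copy (quat R) (can_type tuple_of_quatK).

End QuatChoice.

Section QuatAlgebra.
Variable R : realType.
Implicit Types p q r : quat R.

Definition quat0 : quat R := Quat 0 0 0 0.
Definition quat1 : quat R := Quat 1 0 0 0.
Definition quat_opp q : quat R :=
  Quat (- qre q) (- qim_i q) (- qim_j q) (- qim_k q).
Definition quat_add p q : quat R :=
  Quat (qre p + qre q) (qim_i p + qim_i q)
       (qim_j p + qim_j q) (qim_k p + qim_k q).
Definition quat_mul p q : quat R :=
  let: Quat a1 b1 c1 d1 := p in
  let: Quat a2 b2 c2 d2 := q in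
  Quat (a1 * a2 - b1 * b2 - c1 * c2 - d1 * d2)
       (a1 * b2 + b1 * a2 + c1 * d2 - d1 * c2)
       (a1 * c2 - b1 * d2 + c1 * a2 + d1 * b2)
       (a1 * d2 + b1 * c2 - c1 * b2 + d1 * a2).
Definition quat_scale (x : R) q : quat R :=
  Quat (x * qre q) (x * qim_i q) (x * qim_j q) (x * qim_k q).
Definition quat_conj q : quat R :=
  Quat (qre q) (- qim_i q) (- qim_j q) (- qim_k q).
Definition quat_sqnorm q : R :=
  qre q ^+ 2 + qim_i q ^+ 2 + qim_j q ^+ 2 + qim_k q ^+ 2.
Definition quat_norm q : R := Num.sqrt (quat_sqnorm q).
Definition quat_inv q : quat R := quat_scale (quat_sqnorm q)^-1 (quat_conj q).

Lemma quat_addA : associative quat_add.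
Proof. by move=> p q r; rewrite /quat_add /= !addrA. Qed.

Lemma quat_addC : commutative quat_add.
Proof.
move=> p q; rewrite /quat_add [qre p + _]addrC [qim_i p + _]addrC.
by rewrite [qim_j p + _]addrC [qim_k p + _]addrC.
Qed.

Lemma quat_add0 : left_id quat0 quat_add.
Proof. by case=> a b c d; rewrite /quat_add /= !add0r. Qed.

Lemma quat_addN : left_inverse quat0 quat_opp quat_add.
Proof. by case=> a b c d; rewrite /quat_add /= !addNr. Qed.

HB.instance Definition _ :=
  GRing.isZmodule.Build (quat R) quat_addA quat_addC quat_add0 quat_addN.

Lemma quat_mulA : associative quat_mul.
Proof. by move=> [? ? ? ?] [? ? ? ?] [? ? ? ?] /=; congr Quat; ring. Qed.

Lemma quat_mul1l : left_id quat1 quat_mul.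
Proof. by case=> ? ? ? ? /=; congr Quat; ring. Qed.

Lemma quat_mul1r : right_id quat1 quat_mul.
Proof. by case=> ? ? ? ? /=; congr Quat; ring. Qed.

Lemma quat_mulDl : left_distributive quat_mul quat_add.
Proof.
by move=> [? ? ? ?] [? ? ? ?] [? ? ? ?]; rewrite /quat_add /=; congr Quat; ring.
Qed.

Lemma quat_mulDr : right_distributive quat_mul quat_add.
Proof.
by move=> [? ? ? ?] [? ? ? ?] [? ? ? ?]; rewrite /quat_add /=; congr Quat; ring.
Qed.

Lemma quat1_neq0 : quat1 != quat0.
Proof. by apply/eqP => -[/eqP]; rewrite oner_eq0. Qed.

HB.instance Definition _ :=
  GRing.Zmodule_isNzRing.Build (quat R) quat_mulA quat_mul1l quat_mul1r
    quat_mulDl quat_mulDr quat1_neq0.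

Lemma quat_scaleA (x y : R) q :
  quat_scale x (quat_scale y q) = quat_scale (x * y) q.
Proof. by rewrite /quat_scale /= !mulrA. Qed.

Lemma quat_scale1 : left_id 1 quat_scale.
Proof. by case=> ? ? ? ?; rewrite /quat_scale /= !mul1r. Qed.

Lemma quat_scaleDr : right_distributive quat_scale +%R.
Proof. by move=> x p q; rewrite /quat_scale /= !mulrDr. Qed.

Lemma quat_scaleDl q : {morph quat_scale^~ q : x y / x + y}.
Proof. by move=> x y; rewrite /quat_scale !mulrDl. Qed.

HB.instance Definition _ :=
  GRing.Zmodule_isLmodule.Build R (quat R) quat_scaleA quat_scale1
    quat_scaleDr quat_scaleDl.

Lemma quat_scaleAl (x : R) p q : x *: (p * q) = (x *: p) * q.
Proof.
by case: p q => [? ? ? ?] [? ? ? ?]; congr Quat; rewrite /=; ring.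
Qed.

Lemma quat_scaleAr (x : R) p q : x *: (p * q) = p * (x *: q).
Proof.
by case: p q => [? ? ? ?] [? ? ? ?]; congr Quat; rewrite /=; ring.
Qed.

HB.instance Definition _ :=
  GRing.Lmodule_isLalgebra.Build R (quat R) quat_scaleAl.
HB.instance Definition _ :=
  GRing.Lalgebra_isAlgebra.Build R (quat R) quat_scaleAr.

Lemma quat_sqnorm_ge0 q : 0 <= quat_sqnorm q.
Proof. by rewrite /quat_sqnorm !addr_ge0 ?sqr_ge0. Qed.

Lemma quat_sqnorm_eq0 q : (quat_sqnorm q == 0) = (q == 0).
Proof.
apply/eqP/eqP => [|->]; last by rewrite /quat_sqnorm /= !expr0n /= !addr0.
case: q => a b c d; rewrite /quat_sqnorm /= => /eqP.
rewrite !paddr_eq0 ?addr_ge0 ?sqr_ge0// !sqrf_eq0.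
by move=> /andP[/andP[/andP[/eqP-> /eqP->] /eqP->] /eqP->].
Qed.

Lemma quat_mulVl : {in [pred q : quat R | q != 0], left_inverse 1 quat_inv *%R}.
Proof.
move=> q; rewrite inE -quat_sqnorm_eq0; case: q => a b c d q0.
by congr Quat; move: q0; rewrite /quat_sqnorm /= => q0; field.
Qed.

Lemma quat_mulVr : {in [pred q : quat R | q != 0], right_inverse 1 quat_inv *%R}.
Proof.
move=> q; rewrite inE -quat_sqnorm_eq0; case: q => a b c d q0.
by congr Quat; move: q0; rewrite /quat_sqnorm /= => q0; field.
Qed.

Lemma quat_unitP p q : q * p = 1 /\ p * q = 1 -> p != 0.
Proof.
move=> [qp1 _]; apply/eqP => p0; move: qp1; rewrite p0 mulr0 => /esym/eqP.
by rewrite oner_eq0.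
Qed.

Lemma quat_inv_out : {in [predC [pred q : quat R | q != 0]], quat_inv =1 id}.
Proof.
move=> q; rewrite !inE negbK => /eqP ->.
by rewrite /quat_inv /quat_scale /= !oppr0 !mulr0.
Qed.

HB.instance Definition _ :=
  GRing.NzRing_hasMulInverse.Build (quat R) quat_mulVl quat_mulVr
    quat_unitP quat_inv_out.

Lemma ler_quat_normD p q : quat_norm (p + q) <= quat_norm p + quat_norm q.
Proof.
rewrite -(@ler_pXn2r _ 2) ?nnegrE ?addr_ge0 ?sqrtr_ge0//.
rewrite sqrrD !sqr_sqrtr ?quat_sqnorm_ge0//.
suff : qre p * qre q + qim_i p * qim_i q + qim_j p * qim_j q + qim_k p * qim_k q
       <= quat_norm p * quat_norm q.
  by rewrite /quat_sqnorm /= => ?; lra.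
rewrite -sqrtrM ?quat_sqnorm_ge0//.
set s := (X in X <= _); apply: (le_trans (ler_norm s)).
rewrite -sqrtr_sqr ler_wsqrtr// /s /quat_sqnorm.
case: p q {s} => a b c d [a' b' c' d'] /=; rewrite -subr_ge0.
have -> : (a ^+ 2 + b ^+ 2 + c ^+ 2 + d ^+ 2)
          * (a' ^+ 2 + b' ^+ 2 + c' ^+ 2 + d' ^+ 2)
        - (a * a' + b * b' + c * c' + d * d') ^+ 2
        = (a * b' - b * a') ^+ 2 + (a * c' - c * a') ^+ 2
        + (a * d' - d * a') ^+ 2 + (b * c' - c * b') ^+ 2
        + (b * d' - d * b') ^+ 2 + (c * d' - d * c') ^+ 2 by ring.
by rewrite !addr_ge0 ?sqr_ge0.
Qed.

Lemma quat_normZ (x : R) q : quat_norm (x *: q) = `|x| * quat_norm q.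
Proof.
rewrite -sqrtr_sqr -sqrtrM ?sqr_ge0//; congr Num.sqrt.
by rewrite /quat_sqnorm /=; ring.
Qed.

Lemma quat_norm_eq0 q : quat_norm q = 0 -> q = 0.
Proof.
move/eqP; rewrite sqrtr_eq0 => q0; apply/eqP.
by rewrite -quat_sqnorm_eq0 eq_le q0 quat_sqnorm_ge0.
Qed.

HB.instance Definition _ :=
  Lmodule_isNormed.Build R (quat R) ler_quat_normD quat_normZ quat_norm_eq0.

End QuatAlgebra.

(** * Balls, spheres and slices *)

Section Slices.
Variable R : realType.

Definition qball (r : R) : set (quat R) := [set q | `|q| < r].

Definition imag_units : set (quat R) := [set I | I ^+ 2 = -1].

Definition slice_plane (I : quat R) : set (quat R) :=
  [set q | exists x y : R, q = x%:A + y *: I].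

Definition slice_ball (I : quat R) : set (quat R) := qball 1 `&` slice_plane I.

Definition slice_cball (I : quat R) (r : R) : set (quat R) :=
  [set q | `|q| <= r] `&` slice_plane I.

End Slices.

(** * Slice regular functions

    A function on the unit ball is represented by a total function on [quat R]
    whose values off the ball play no role. At q = x + y I the directional
    derivatives ['D_1 f q] and ['D_I f q] are the partial derivatives with
    respect to x and y of the restriction of f to the slice of I. *)

Section SliceRegular.
Variable R : realType.
Implicit Types (f : quat R -> quat R) (I : quat R).

Definition slice_regular f :=
  forall I, imag_units I ->
  [/\ forall q, slice_ball I q -> derivable f q 1 /\ derivable f q I,
      {within slice_ball I, continuous ('D_1 f)},
      {within slice_ball I, continuous ('D_I f)} &
      forall q, slice_ball I q -> 2^-1 *: ('D_1 f q + I * 'D_I f q) = 0].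

Definition slice_derivative f : quat R -> quat R := 'D_1 f.

(** The sequence a such that f(q) = sum_n q^n a_n on the unit ball; it exists
    and is unique when f is slice regular. *)
Definition coefs f : nat -> quat R :=
  get [set a : nat -> quat R | forall q, qball 1 q ->
         series (fun n => q ^+ n * a n) @ \oo --> f q].

End SliceRegular.

(** * The 3-diameter and the slice 3-diameter *)

Section ThreeDiameter.
Variable R : realType.
Implicit Types (E : set (quat R)) (f : quat R -> quat R).

Definition d3 E : \bar R :=
  ereal_sup [set x | exists w1 w2 w3, [/\ E w1, E w2, E w3 &
    x = ((`|w2 - w1| * `|w3 - w1| * `|w3 - w2|) `^ 3^-1)%:E]].

(** b_n = a_n a_N^-1 |a_N|, with a_N the first nonzero coefficient of f. *)
Definition normalized_coefs f : nat -> quat R :=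
  let a := coefs f in
  if pselect (exists n, a n != 0) is left ex then
    let aN := a (ex_minn ex) in fun n => `|aN| *: (a n * aN^-1)
  else fun=> 0.

Definition ghat f (w1 w2 w3 z : quat R) : quat R :=
  let b := normalized_coefs f in
  limn (series (fun n => z ^+ n *
    \sum_(k < n.+1) \sum_(j < k.+1)
      (w2 ^+ j - w1 ^+ j) * (w3 ^+ (k - j) - w1 ^+ (k - j))
      * (w3 ^+ (n - k) - w2 ^+ (n - k))
      * b j * b (k - j)%N * b (n - k)%N)).

(** The supremum over I of the maxima over w1, w2, w3, z, taken as a single
    supremum. *)
Definition slice_d3_ball f (r : R) : \bar R :=
  ereal_sup [set x | exists I w1 w2 w3 z, [/\ imag_units I,
    [/\ slice_cball I 1 w1, slice_cball I 1 w2 & slice_cball I 1 w3],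
    slice_cball I r z &
    x = (`|ghat f w1 w2 w3 z| `^ 3^-1)%:E]].

Definition slice_d3 f : \bar R := lim (slice_d3_ball f r @[r --> 1^'-]).

End ThreeDiameter.

(* Main.v *)
Require Import Defs.
From HB Require Import structures.
From mathcomp Require Import all_boot all_order all_algebra.
From mathcomp Require Import all_classical all_reals all_analysis.
From mathcomp Require Import ring lra zify.

Set Implicit Arguments.
Unset Strict Implicit.
Unset Printing Implicit Defensive.

Import Order.TTheory GRing.Theory Num.Theory.
Import numFieldNormedType.Exports.
Local Open Scope classical_set_scope.
Local Open Scope ring_scope.

(** For a triangle w = (w1, w2, w3) in the closed unit disc of a slice, the cubic
    series ghat_w(z) starts with the term z^3 V(w) b_1^3, where V(w) is the
    product of the differences of the w_i, and |V(w)| is at most M = 3 sqrt 3,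
    with equality for the equilateral triangle on the circle. Since M is the cube
    of the 3-diameter of the unit ball, the hypothesis on the slice 3-diameter says
    that |ghat_w(z)| <= M for all slices, all triangles and all |z| < 1. Schwarz's
    lemma ([schwarz3]) improves this to |ghat_w(z)| <= M |z|^3, which is the
    bound on the slice 3-diameters of the smaller balls; at the centre, for the
    equilateral triangle, it says |b_1| <= 1, which is the bound on the slice
    derivative because |b_1| = |a_1|. If |b_1| < 1, Harnack's inequality keeps
    |ghat_w(z) / z^3| uniformly below M on smaller discs, so that the
    first bound is strict ([slice_d3_ball_lt]). Hence equality anywhere forces |b_1| = 1.

    Suppose |b_1| = 1 and let b_k be the first nonzero coefficient with k >= 2. By
    Caratheodory's coefficient inequality the real part of the coefficient of
    degree k + 2 of ghat_w, suitably rotated, is at most a constant times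
    M - |V(w)|. Along the isosceles triangles w = (1, x, 1/x) this slack vanishes
    to second order at the equilateral triangle, whereas the coefficient is a
    combination of b_k and its conjugates by b_1 with explicit trigonometric
    factors that do not vanish to second order. Letting the slice vary, this
    gives b_k = 0 ([next_coefficient_eq0]): f is affine. Conversely the slice
    derivative at 0 of q |-> a + q b is b.

    The facts of function theory are proved slice by slice, and circle means are
    averages over roots of unity. For a power series these averages are computed
    by orthogonality, and their positivity against a positive kernel gives
    Caratheodory's and Harnack's inequalities ([mean_kernel_ge0]). That a slice
    regular function has a power series ([slice_taylor]) is Cauchy's formula: by
    the Cauchy-Riemann equation an increment q' - q in the slice changes f by
    (q' - q) f'(q) up to a small error, and the increments between consecutive
    roots of unity telescope to 0. *)

(** * The modulus and the real part of a quaternion *)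

Section Modulus.
Variable R : realType.
Implicit Types (p q u v : quat R) (x y : R).

Lemma quat_normE q : `|q| = Num.sqrt (quat_sqnorm q).
Proof. by []. Qed.

Lemma quat_norm_sqr q : `|q| ^+ 2 = quat_sqnorm q.
Proof. by rewrite quat_normE sqr_sqrtr ?quat_sqnorm_ge0. Qed.

Lemma quat_normM p q : `|p * q| = `|p| * `|q|.
Proof.
rewrite !quat_normE -sqrtrM ?quat_sqnorm_ge0//; congr Num.sqrt.
by case: p q => [? ? ? ?] [? ? ? ?]; rewrite /quat_sqnorm /=; ring.
Qed.

Lemma quat_norm1 : `|1 : quat R| = 1.
Proof.
by rewrite quat_normE /quat_sqnorm /= expr1n !expr0n/= !addr0 sqrtr1.
Qed.

Lemma quat_normX q n : `|q ^+ n| = `|q| ^+ n.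
Proof.
elim: n => [|n IHn]; first by rewrite !expr0 quat_norm1.
by rewrite !exprS quat_normM IHn.
Qed.

Lemma quat_unitE q : (q \is a GRing.unit) = (q != 0).
Proof. by []. Qed.

Lemma quat_normV q : `|q^-1| = `|q|^-1.
Proof.
have [->|q0] := eqVneq q 0; first by rewrite invr0 !normr0 invr0.
have nq0 : `|q| != 0 by rewrite normr_eq0.
apply: (mulfI nq0); rewrite -quat_normM divrr ?quat_unitE// quat_norm1.
by rewrite divff.
Qed.

Lemma quat_norm_alg x : `|x%:A : quat R| = `|x|.
Proof. by rewrite normrZ quat_norm1 mulr1. Qed.

Fact qre_is_linear : linear (@qre R).
Proof. by []. Qed.
HB.instance Definition _ := GRing.isLinear.Build R (quat R) R _ (@qre R)
  qre_is_linear.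

Lemma qreZ x q : qre (x *: q) = x * qre q.
Proof. by []. Qed.

Lemma qreB p q : qre (p - q) = qre p - qre q.
Proof. by []. Qed.

Lemma ler_qre q : qre q <= `|q|.
Proof.
rewrite (le_trans (ler_norm _))// -sqrtr_sqr ler_wsqrtr// /quat_sqnorm.
by rewrite -!addrA lerDl !addr_ge0 ?sqr_ge0.
Qed.

Lemma ler_abs_qre q : `|qre q| <= `|q|.
Proof.
by rewrite ler_norml ler_qre andbT; have := ler_qre (- q); rewrite normrN /= lerNl.
Qed.

Lemma quat_conjM q : q * quat_conj q = (`|q| ^+ 2)%:A.
Proof.
rewrite quat_norm_sqr; case: q => a b c d; rewrite /quat_sqnorm /=.
by congr Quat; rewrite /=; ring.
Qed.

Lemma quat_norm_conj q : `|quat_conj q| = `|q|.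
Proof. by rewrite !quat_normE /quat_sqnorm /= !sqrrN. Qed.

(** The worst direction u is the conjugate of q, normalized. This turns bounds
    on real-valued harmonic functions into bounds on moduli. *)
Lemma quat_norm_le_qre q (M : R) :
  (forall u, `|u| = 1 -> qre (q * u) <= M) -> `|q| <= M.
Proof.
move=> qM; have [q0|q0] := eqVneq q 0.
  by have := qM 1 quat_norm1; rewrite mulr1 q0 normr0.
have nq0 : `|q| != 0 by rewrite normr_eq0.
have := qM (`|q|^-1 *: quat_conj q).
rewrite normrZ quat_norm_conj normfV normr_id mulVf// => /(_ erefl).
rewrite -scalerAr quat_conjM /= mulr1.
by rewrite expr2 mulrA mulVf// mul1r.
Qed.

End Modulus.

(** * The exponential of a slice *)

Section Slice.
Variable R : realType.
Implicit Types (I p q z : quat R) (s t x y : R).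

Definition expI I t : quat R := (cos t)%:A + sin t *: I.

Lemma imag_unitP I : imag_units I <-> (qre I = 0 /\ `|I| = 1).
Proof.
rewrite /imag_units /= expr2; split => [|[]].
  have norm1 : I * I = -1 -> `|I| = 1.
    move=> II; have : `|I| ^+ 2 = 1 by rewrite expr2 -quat_normM II normrN quat_norm1.
    by move/eqP; rewrite sqrp_eq1// => /eqP.
  move=> II; split; last exact: norm1.
  have := quat_norm_sqr I; rewrite norm1//; case: I II norm1 => a b c d.
  by rewrite /quat_sqnorm/= => -[+ _ _ _ _]; nra.
rewrite -[`|I| = 1]/(Num.sqrt _ = 1) => I0 I1.
have : quat_sqnorm I = 1 by rewrite -quat_norm_sqr [`|I|]I1 expr1n.
case: I I0 {I1} => a b c d /= -> ; rewrite /quat_sqnorm/= => e1.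
by congr Quat => /=; try lra; ring.
Qed.

Lemma imag_unit_sqr I : imag_units I -> I * I = -1.
Proof. by rewrite /imag_units /= expr2. Qed.

Lemma expI_in_plane I t : slice_plane I (expI I t).
Proof. by exists (cos t), (sin t). Qed.

Lemma in_plane_alg I x : slice_plane I x%:A.
Proof. by exists x, 0; rewrite scale0r addr0. Qed.

Lemma in_planeD I p q : slice_plane I p -> slice_plane I q -> slice_plane I (p + q).
Proof.
move=> [x [y ->]] [x' [y' ->]].
by exists (x + x'), (y + y'); rewrite !scalerDl addrACA.
Qed.

Lemma in_planeZ I a p : slice_plane I p -> slice_plane I (a *: p).
Proof.
move=> [x [y ->]].
by exists (a * x), (a * y); rewrite scalerDr !scalerA.
Qed.

Lemma in_planeN I p : slice_plane I p -> slice_plane I (- p).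
Proof. by rewrite -scaleN1r => /in_planeZ; exact. Qed.

Lemma in_planeB I p q : slice_plane I p -> slice_plane I q -> slice_plane I (p - q).
Proof. by move=> pI qI; apply/in_planeD => //; apply/in_planeN. Qed.

Lemma plane_mulE I x y x' y' : imag_units I ->
  (x%:A + y *: I) * (x'%:A + y' *: I) =
  (x * x' - y * y')%:A + (x * y' + y * x') *: I.
Proof.
move=> /imag_unit_sqr II.
rewrite mulrDl !mulrDr -!scalerAl -!scalerAr !mul1r !mulr1 II !scalerA scalerN.
rewrite !scalerDl scaleNr -!addrA; congr (_ + _).
by rewrite [RHS]addrC -!addrA; congr (_ + _); rewrite addrC.
Qed.

Lemma in_planeM I p q : imag_units I ->
  slice_plane I p -> slice_plane I q -> slice_plane I (p * q).
Proof.
move=> uI [x [y ->]] [x' [y' ->]].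
by rewrite plane_mulE//; do 2 eexists; reflexivity.
Qed.

Lemma in_plane1 I : slice_plane I 1.
Proof. by rewrite -[1]scale1r; exact: in_plane_alg. Qed.

Lemma in_plane_comm I p q :
  slice_plane I p -> slice_plane I q -> p * q = q * p.
Proof.
move=> [x [y ->]] [x' [y' ->]].
rewrite !mulrDl !mulrDr -!scalerAl -!scalerAr !mul1r !mulr1.
rewrite !scalerA [x * _]mulrC [x * y']mulrC [y * x']mulrC [y * y']mulrC.
rewrite -!addrA; congr (_ + _); rewrite addrCA; congr (_ + (_ + _)).
Qed.

Lemma in_plane_sqnorm I x y : imag_units I ->
  `|x%:A + y *: I| ^+ 2 = x ^+ 2 + y ^+ 2.
Proof.
move=> /imag_unitP[]; case: I => a b c d /= -> n1.
have := quat_norm_sqr (Quat 0 b c d); rewrite n1 /quat_sqnorm /= => e.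
rewrite quat_norm_sqr /quat_sqnorm /=.
have -> : (x * 1 + y * 0) ^+ 2 + (x * 0 + y * b) ^+ 2 + (x * 0 + y * c) ^+ 2 +
  (x * 0 + y * d) ^+ 2
  = x ^+ 2 + y ^+ 2 * (0 ^+ 2 + b ^+ 2 + c ^+ 2 + d ^+ 2) by ring.
by rewrite -e expr1n mulr1.
Qed.

Lemma norm_expI I t : imag_units I -> `|expI I t| = 1.
Proof.
move=> uI; have : `|expI I t| ^+ 2 = 1 by rewrite in_plane_sqnorm// cos2Dsin2.
by move/eqP; rewrite sqrp_eq1// => /eqP.
Qed.

Lemma expI0 I : expI I 0 = 1.
Proof. by rewrite /expI cos0 sin0 scale0r addr0 scale1r. Qed.

Lemma expID I s t : imag_units I -> expI I (s + t) = expI I s * expI I t.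
Proof.
by move=> uI; rewrite /expI plane_mulE// cosD sinD [_ + cos s * sin t]addrC.
Qed.

Lemma expIX I t n : imag_units I -> expI I t ^+ n = expI I (n%:R * t).
Proof.
move=> uI; elim: n => [|n IHn]; first by rewrite mul0r expI0 expr0.
by rewrite exprS IHn -expID// -[n.+1]add1n natrD mulrDl mul1r.
Qed.

Lemma expI2pi I t : expI I (t + pi *+ 2) = expI I t.
Proof. by rewrite /expI cosD2pi sinD2pi. Qed.

Lemma plane_polar I z : imag_units I -> slice_plane I z ->
  exists2 t, `|t| <= pi & z = `|z| *: expI I t.
Proof.
move=> uI [x [y zE]].
have n2 := in_plane_sqnorm x y uI; rewrite -zE in n2.
have [z0|z0] := eqVneq z 0; first by exists 0; rewrite ?z0 normr0 ?scale0r ?pi_ge0.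
have nz : 0 < `|z| by rewrite normr_gt0.
have nz0 : `|z| != 0 by rewrite gt_eqF.
have [xb|xb] := boolP (-1 <= x / `|z| <= 1); last first.
  case/negP: xb; rewrite -ler_norml normrM normfV normr_id ler_pdivrMr// mul1r.
  by rewrite -(@ler_pXn2r _ 2) ?nnegrE// n2 real_normK ?num_real// lerDl sqr_ge0.
have yE : (y / `|z|) ^+ 2 = 1 - (x / `|z|) ^+ 2.
  have := divff (expf_neq0 2 nz0); rewrite !expr_div_n {1}n2 mulrDl => <-.
  by rewrite addrAC subrr add0r.
have sE : sin (acos (x / `|z|)) = `|y / `|z| |.
  by rewrite sin_acos// -yE sqrtr_sqr.
have cE := acosK xb.
have scal : `|z| *: ((x / `|z|)%:A + (y / `|z|) *: I) = z.
  by rewrite scalerDr !scalerA ![`|z| * _]mulrC !divfK.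
have aE : `|acos (x / `|z|)| <= pi by rewrite ger0_norm ?acos_ge0// acos_lepi.
have [y0|y0] := leP 0 (y / `|z|).
  by exists (acos (x / `|z|)); rewrite // /expI cE sE ger0_norm.
exists (- acos (x / `|z|)); rewrite ?normrN// /expI cosN sinN cE sE.
by rewrite ltr0_norm// opprK.
Qed.

Lemma in_some_slice q : exists2 I, imag_units I & slice_plane I q.
Proof.
case: q => a b c d.
have [v0|v0] := eqVneq (Quat 0 b c d) 0.
  case: v0 => -> -> ->; exists (Quat 0 1 0 0).
    by apply/imag_unitP; split => //; rewrite quat_normE /quat_sqnorm/= !expr0n/= expr1n !addr0 add0r sqrtr1.
  by exists a, 0; congr Quat => /=; ring.
have nv : `|Quat 0 b c d| != 0 by rewrite normr_eq0.
exists (`|Quat 0 b c d|^-1 *: Quat 0 b c d).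
  apply/imag_unitP; split; first by rewrite /= mulr0.
  by rewrite normrZ normfV normr_id mulVf.
exists a, `|Quat 0 b c d|; rewrite scalerA divff// scale1r.
by congr Quat => /=; ring.
Qed.

Lemma expI_opp I t : expI I (- t) = expI (- I) t.
Proof. by rewrite /expI cosN sinN scalerN scaleNr. Qed.

Lemma imag_unitsN I : imag_units I -> imag_units (- I).
Proof. by rewrite /imag_units/= sqrrN. Qed.

Lemma plane_triple I (x y x' y' x'' y'' : R) : imag_units I ->
  (x%:A + y *: I) * (x'%:A + y' *: I) * (x''%:A + y'' *: I) =
  ((x * x' - y * y') * x'' - (x * y' + y * x') * y'')%:A +
  ((x * x' - y * y') * y'' + (x * y' + y * x') * x'') *: I.
Proof. by move=> uI; rewrite !plane_mulE. Qed.

Lemma expI_sub1 I t : expI I t - 1 = (cos t - 1)%:A + sin t *: I.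
Proof. by rewrite /expI addrAC -[X in _ - X + _]scale1r -scalerBl. Qed.

Lemma expIN_sub1 I t : expI I (- t) - 1 = (cos t - 1)%:A + (- sin t) *: I.
Proof. by rewrite expI_sub1 cosN sinN. Qed.

Lemma expIN_sub_expI I t : expI I (- t) - expI I t = 0%:A + (- (2 * sin t)) *: I.
Proof.
rewrite /expI cosN sinN opprD addrACA subrr -scalerBl scale0r.
by congr (_ + _ *: _); lra.
Qed.

Lemma quat_eq0_slices (p : quat R) :
  (forall I s, imag_units I -> qre (expI I s * p) = 0) -> p = 0.
Proof.
have unit_i : imag_units (Quat 0 1 0 0 : quat R).
  by rewrite /imag_units/=; congr Quat => /=; ring.
have unit_j : imag_units (Quat 0 0 1 0 : quat R).
  by rewrite /imag_units/=; congr Quat => /=; ring.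
have unit_k : imag_units (Quat 0 0 0 1 : quat R).
  by rewrite /imag_units/=; congr Quat => /=; ring.
move=> p0; have := p0 _ (pi / 2) unit_i; have := p0 _ (pi / 2) unit_j.
have := p0 _ (pi / 2) unit_k; have := p0 _ 0 unit_i.
(* The angles 0 and pi / 2 read off the components of p. *)
rewrite expI0 mul1r /expI cos_pihalf sin_pihalf scale0r add0r scale1r.
case: p {p0} => x1 x2 x3 x4 /= e1 e4 e3 e2.
by congr Quat => /=; lra.
Qed.

Lemma expI_addpi I s : expI I (s + pi) = - expI I s.
Proof. by rewrite /expI cosDpi sinDpi opprD !scaleNr. Qed.

End Slice.

(** * Geometric errors *)

Section RealSequences.
Variable R : realType.
Implicit Types (a b C y : R).

Lemma geometric_small C y e : 0 <= y < 1 -> 0 < e ->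
  exists N0, forall N, (N0 <= N)%N -> C * y ^+ N < e.
Proof.
move=> /andP[y0 y1] e0.
have : C * y ^+ n @[n --> \oo] --> (0 : R).
  by apply: (@cvg_geometric R); rewrite ger0_norm.
move=> /cvgr0Pnorm_lt /(_ _ e0) [N0 _ CN].
by exists N0 => N /CN; apply: le_lt_trans; exact: ler_norm.
Qed.

(** All limits below are taken in this form: every error term is geometric. *)
Lemma le_geometric_error a b C y N0 : 0 <= y < 1 ->
  (forall N, (N0 <= N)%N -> a <= b + C * y ^+ N) -> a <= b.
Proof.
move=> y01 abC; rewrite leNgt; apply/negP => ba.
have ab0 : 0 < a - b by rewrite subr_gt0.
have [N1 CN] := geometric_small C y01 ab0.
by have := CN _ (leq_maxr N0 N1); rewrite ltrBrDl ltNge abC// leq_maxl.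
Qed.

Lemma bernoulli_ge (t : R) n : 0 <= t -> 1 + n%:R * t <= (1 + t) ^+ n.
Proof.
move=> t0; elim: n => [|n IHn]; first by rewrite mul0r addr0 expr0.
have t1 : 0 <= 1 + t by rewrite addr_ge0.
rewrite exprS; apply: le_trans (ler_wpM2l t1 IHn).
rewrite -natr1; have : 0 <= n%:R * t * t by rewrite !mulr_ge0.
by lra.
Qed.

Lemma nondecreasing_le_lim_left (g : R -> \bar R) (a r : R) :
  {homo g : x y / (x <= y)%R >-> (x <= y)%E} -> r < a ->
  (g r <= lim (g x @[x --> a^'-]))%E.
Proof.
move=> gnd ra; apply: lime_ge.
  apply/cvg_ex; eexists; apply/cvg_at_leftNP.
  apply: (@nonincreasing_at_right_cvge _ _ _ (BInfty _ false)) => //.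
  by move=> x y _ _ xy; apply: gnd; rewrite lerN2.
near=> x; apply: gnd; near: x; exact: nbhs_left_ge.
Unshelve. all: by end_near. Qed.

End RealSequences.

(** * Quaternionic power series *)

Section Series.
Variable R : realType.
Implicit Types (u e : nat -> quat R) (p q z : quat R).

Lemma cvg_quat u : cvgn (@qre R \o u) -> cvgn (@qim_i R \o u) ->
  cvgn (@qim_j R \o u) -> cvgn (@qim_k R \o u) -> cvgn u.
Proof.
move=> ca cb cc cd.
rewrite (_ : u = fun n => qre (u n) *: (Quat 1 0 0 0) + qim_i (u n) *: (Quat 0 1 0 0)
  + qim_j (u n) *: (Quat 0 0 1 0) + qim_k (u n) *: (Quat 0 0 0 1)); last first.
  by apply/funext => n; case: (u n) => a b c d; congr Quat => /=; ring.
by apply: is_cvgD; [apply: is_cvgD; [apply: is_cvgD|]|];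
  apply: is_cvgZr_tmp.
Qed.

Lemma geometric_sum_le (y : R) n : 0 <= y < 1 ->
  \sum_(k < n) y ^+ k <= (1 - y)^-1.
Proof.
move=> /andP[y0 y1]; have y1' : 0 < 1 - y by rewrite subr_gt0.
rewrite -(@ler_pM2l _ (1 - y))// divff ?gt_eqF//.
have := subrX1 y n; rewrite -opprB -[y - 1]opprB mulNr => /oppr_inj <-.
by rewrite gerBl exprn_ge0.
Qed.

(** Componentwise comparison with a geometric series. *)
Lemma geometric_tail u (C y : R) : 0 <= y < 1 ->
  (forall n, `|u n| <= C * y ^+ n) ->
  series u @ \oo --> limn (series u) /\
  forall N, `|limn (series u) - \sum_(n < N) u n| <= C / (1 - y) * y ^+ N.
Proof.
move=> y01 uC; have /andP[y0 y1] := y01.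
have C0 : 0 <= C by have := uC 0%N; rewrite expr0 mulr1; apply: le_trans.
have cvu : cvgn (series u).
  have comp (pr : quat R -> R) : {morph pr : p q / p + q} -> pr 0 = 0 ->
      (forall q, `|pr q| <= `|q|) -> cvgn (pr \o series u).
    move=> prD pr0 prle.
    have -> : pr \o series u = series (pr \o u).
      by apply/funext => n /=; rewrite /series/= (big_morph pr prD pr0).
    apply: normed_cvg; apply: (@series_le_cvg _ _ (geometric C y)).
    - by move=> n /=.
    - by move=> n /=; rewrite mulr_ge0// exprn_ge0.
    - by move=> n /=; exact: le_trans (prle _) (uC n).
    - by apply: is_cvg_geometric_series; rewrite ger0_norm.
  have le_comp (a b : R) : 0 <= b -> `|a| <= Num.sqrt (a ^+ 2 + b).
    by move=> b0; rewrite -sqrtr_sqr ler_wsqrtr// lerDl.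
  apply: cvg_quat; apply: comp => // q; rewrite quat_normE /quat_sqnorm.
  - by rewrite -!addrA le_comp// !addr_ge0 ?sqr_ge0.
  - by rewrite [qre q ^+ 2 + _]addrC -!addrA le_comp// !addr_ge0 ?sqr_ge0.
  - by rewrite [_ + qim_j q ^+ 2]addrC -!addrA le_comp// !addr_ge0 ?sqr_ge0.
  - by rewrite addrC le_comp// !addr_ge0 ?sqr_ge0.
split=> // N.
have cvd : `|series u n - \sum_(k < N) u k| @[n --> \oo] -->
    `|limn (series u) - \sum_(k < N) u k|.
  by apply: cvg_norm; apply: cvgB => //; exact: cvg_cst.
rewrite -(cvg_lim _ cvd)//; apply: limr_le; first exact: cvgP cvd.
exists N => // n /= Nn; rewrite /series /= big_mkord.
rewrite -(subnKC Nn) big_split_ord/= addrC addrK.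
apply: le_trans (ler_norm_sum _ _ _) _.
apply: (@le_trans _ _ (\sum_(i < n - N) C * y ^+ N * y ^+ i)).
  by apply: ler_sum => i _; apply: le_trans (uC _) _; rewrite exprD mulrA.
rewrite -mulr_sumr [leRHS]mulrAC ler_wpM2l ?mulr_ge0 ?exprn_ge0//.
exact: geometric_sum_le.
Qed.

Definition psum e q : quat R := limn (series (fun n => q ^+ n * e n)).

(** The coefficients of the power series whose radius of convergence is at
    least 1. *)
Definition subgeometric e :=
  forall s : R, 1 < s -> exists C, forall n, `|e n| <= C * s ^+ n.

Lemma psum_geometric e (r : R) : subgeometric e -> 0 <= r < 1 ->
  exists C y, [/\ 0 <= y < 1, 0 <= C & forall q, `|q| <= r ->
    series (fun n => q ^+ n * e n) @ \oo --> psum e q /\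
    forall N, `|psum e q - \sum_(n < N) q ^+ n * e n| <= C * y ^+ N].
Proof.
move=> eg /andP[r0 r1]; have r1' : 0 < 1 + r by lra.
have [|C Ce] := eg (2 / (1 + r)); first by rewrite ltr_pdivlMr//; lra.
pose y := 2 / (1 + r) * r.
have y01 : 0 <= y < 1.
  apply/andP; split; first by rewrite mulr_ge0// divr_ge0// ltW.
  by rewrite /y mulrAC ltr_pdivrMr//; lra.
have C0 : 0 <= C by have := Ce 0%N; rewrite expr0 mulr1; apply: le_trans.
exists (C / (1 - y)), y; split => //.
  by rewrite divr_ge0// subr_ge0; case/andP: y01 => _ /ltW.
move=> q qr; apply: geometric_tail => // n.
rewrite quat_normM quat_normX mulrC /y exprMn mulrA ler_pM ?exprn_ge0//.
by rewrite lerXn2r ?nnegrE.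
Qed.

Lemma psum_cvg e q : subgeometric e -> `|q| < 1 ->
  series (fun n => q ^+ n * e n) @ \oo --> psum e q.
Proof.
move=> eg q1; have q01 : 0 <= `|q| < 1 by rewrite normr_ge0.
by have [C [y [_ _ /(_ q (lexx _))[]]]] := psum_geometric eg q01.
Qed.

Lemma eq_geometric_error p q (C y : R) N0 : 0 <= y < 1 ->
  (forall N, (N0 <= N)%N -> `|p - q| <= C * y ^+ N) -> p = q.
Proof.
move=> y01 pq; apply/eqP; rewrite -subr_eq0 -normr_le0.
by apply: (le_geometric_error (N0 := N0) y01) => N /pq; rewrite add0r; exact.
Qed.

Lemma psum_eq e q p (C y : R) : 0 <= y < 1 ->
  (forall N, `|p - \sum_(n < N) q ^+ n * e n| <= C * y ^+ N) -> psum e q = p.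
Proof.
move=> y01 pC; apply: cvg_lim => //; apply/cvgrPdist_lt => eps eps0.
have [N0 CN] := geometric_small C y01 eps0.
exists N0 => // N /= /CN; apply: le_lt_trans.
by rewrite /series/= big_mkord.
Qed.

Lemma subgeometricMl v e : subgeometric e -> subgeometric (fun n => v * e n).
Proof.
move=> eg s s1; have [C Ce] := eg s s1; exists (`|v| * C) => n.
by rewrite quat_normM -mulrA ler_wpM2l.
Qed.

Lemma subgeometricMr v e : subgeometric e -> subgeometric (fun n => e n * v).
Proof.
move=> eg s s1; have [C Ce] := eg s s1; exists (C * `|v|) => n.
by rewrite quat_normM mulrAC ler_wpM2r.
Qed.

Lemma subgeometricD e1 e2 : subgeometric e1 -> subgeometric e2 ->
  subgeometric (fun n => e1 n + e2 n).
Proof.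
move=> eg1 eg2 s s1; have [C Ce] := eg1 s s1; have [D De] := eg2 s s1.
by exists (C + D) => n; rewrite mulrDl (le_trans (ler_normD _ _))// lerD.
Qed.

Lemma subgeometric_shift e m : subgeometric e ->
  subgeometric (fun n => e (n + m)%N).
Proof.
move=> eg s s1; have [C Ce] := eg s s1; exists (C * s ^+ m) => n.
by rewrite -mulrA -exprD addnC.
Qed.

Lemma subgeometric_const v : subgeometric (fun n => if n == 0%N then v else 0).
Proof.
move=> s s1; exists `|v| => -[|n] /=; first by rewrite expr0 mulr1.
by rewrite normr0 mulr_ge0// exprn_ge0//; lra.
Qed.

Lemma psumM e q v w : subgeometric e -> `|q| < 1 -> v * q = q * v ->
  psum (fun n => v * e n * w) q = v * psum e q * w.
Proof.
move=> eg q1 vq; have q01 : 0 <= `|q| < 1 by rewrite normr_ge0.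
have [C [y [y01 C0 /(_ q (lexx _))[_ Ce]]]] := psum_geometric eg q01.
apply: (psum_eq (C := `|v| * C * `|w|) y01) => N.
have -> : \sum_(n < N) q ^+ n * (v * e n * w) =
    v * (\sum_(n < N) q ^+ n * e n) * w.
  rewrite mulr_sumr mulr_suml; apply: eq_bigr => n _.
  by rewrite !mulrA -(commrX n (vq : GRing.comm v q)).
rewrite -mulrBl -mulrBr !quat_normM -[leRHS]mulrA [`|w| * _]mulrC mulrA.
by rewrite ler_wpM2r// -mulrA ler_wpM2l.
Qed.

Lemma psumD e1 e2 q : subgeometric e1 -> subgeometric e2 -> `|q| < 1 ->
  psum (fun n => e1 n + e2 n) q = psum e1 q + psum e2 q.
Proof.
move=> eg1 eg2 q1; apply: cvg_lim => //.
rewrite (_ : series _ = series (fun n => q ^+ n * e1 n) +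
  series (fun n => q ^+ n * e2 n)).
  by apply: cvgD; exact: psum_cvg.
apply/funext => n; rewrite /series/= -[RHS]/(_ + _) -big_split/=.
by apply: eq_bigr => k _; rewrite mulrDr.
Qed.

Lemma psum_const v q : psum (fun n => if n == 0%N then v else 0) q = v.
Proof.
apply: (@psum_eq _ _ _ `|v| 0) => [|[|N]]; first by rewrite lexx ltr01.
  by rewrite big_ord0 subr0 expr0 mulr1.
rewrite big_ord_recl expr0 mul1r big1 ?addr0 ?subrr ?normr0 ?expr0n ?mulr0//.
by move=> i _; rewrite mulr0.
Qed.

Lemma psum0 e : psum e 0 = e 0%N.
Proof.
apply: (@psum_eq _ _ _ `|e 0%N| 0) => [|[|N]]; first by rewrite lexx ltr01.
  by rewrite big_ord0 subr0 expr0 mulr1.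
rewrite big_ord_recl expr0 mul1r big1 ?addr0 ?subrr ?normr0 ?expr0n ?mulr0//.
by move=> i _; rewrite exprS !mul0r.
Qed.

Lemma psum_shift e q m : subgeometric e -> `|q| < 1 ->
  (forall n, (n < m)%N -> e n = 0) ->
  psum e q = q ^+ m * psum (fun n => e (n + m)%N) q.
Proof.
move=> eg q1 e0; have q01 : 0 <= `|q| < 1 by rewrite normr_ge0.
have [C [y [y01 C0 /(_ q (lexx _))[_ Ce]]]] := psum_geometric eg q01.
have [D [x [x01 D0 /(_ q (lexx _))[_ De]]]] :=
  psum_geometric (subgeometric_shift m eg) q01.
apply: cvg_lim => //.
rewrite -(cvg_shiftn m).
apply/cvgrPdist_lt => eps eps0; have [N0 CN] := geometric_small D x01 eps0.
exists N0 => // N /= /CN; apply: le_lt_trans.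
rewrite /series/= big_mkord [(N + m)%N]addnC big_split_ord/=.
rewrite big1 => [|i _]; last by rewrite e0// mulr0.
rewrite add0r (_ : \sum_(_ < N) _ = q ^+ m * \sum_(n < N) q ^+ n * e (n + m)%N).
  rewrite -mulrBr quat_normM quat_normX (le_trans _ (De N))//.
  by rewrite ler_piMl// exprn_ile1// ltW.
by rewrite mulr_sumr; apply: eq_bigr => i _; rewrite mulrA -exprD addnC.
Qed.

End Series.

(** * Averages over roots of unity *)

Section RootsOfUnity.
Variable R : realType.
Implicit Types (I : quat R) (t : R).

Definition root_angle m k : R := k%:R * (pi *+ 2 / m%:R).

Lemma expI_neq1 I t : imag_units I -> 0 < t < pi *+ 2 -> expI I t != 1.
Proof.
move=> /imag_unitP[I0 _] /andP[t0 t2]; apply/eqP => /(congr1 (@qre R)).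
rewrite /= I0 mulr0 addr0 mulr1 (splitr t) cosD => c1.
have s0 : 0 < sin (t / 2).
  apply: sin_gt0_pi; rewrite divr_gt0//= ltr_pdivrMr// mulr_natr.
  exact: t2.
have := cos2Dsin2 (t / 2); rewrite !expr2 => cs.
have : 0 < sin (t / 2) * sin (t / 2) by rewrite mulr_gt0.
by lra.
Qed.

Lemma expI_2pi_natmul I j : expI I (j%:R * (pi *+ 2)) = 1.
Proof.
elim: j => [|j IHj]; first by rewrite mul0r expI0.
by rewrite -natr1 mulrDl mul1r expI2pi.
Qed.

Lemma sum_roots I j m : imag_units I -> (j < m)%N ->
  \sum_(k < m) expI I (j%:R * root_angle m k) = (m%:R * (j == 0%N)%:R)%:A.
Proof.
move=> uI jm; have m0 : m%:R != 0 :> R by rewrite pnatr_eq0 -lt0n; case: m jm.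
have [->|j0] := eqVneq j 0%N.
  under eq_bigr do rewrite mul0r expI0.
  by rewrite sumr_const card_ord mulr1 scaler_nat.
rewrite mulr0 scale0r; pose w := expI I (j%:R * (pi *+ 2 / m%:R)).
have -> : \sum_(k < m) expI I (j%:R * root_angle m k) = \sum_(k < m) w ^+ k.
  by apply: eq_bigr => k _; rewrite /w expIX// /root_angle mulrCA.
have w1 : w != 1.
  have m1 : 0 < m%:R :> R by rewrite ltr0n; case: m jm {m0 w}.
  have j1 : 0 < j%:R :> R by rewrite ltr0n lt0n.
  have pi2 : 0 < pi *+ 2 :> R by rewrite mulrn_wgt0// pi_gt0.
  apply: expI_neq1 => //; rewrite mulr_gt0 ?divr_gt0//=.
  rewrite mulrCA -[ltRHS]mulr1 ltr_pM2l//.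
  by rewrite ltr_pdivrMr// mul1r ltr_nat.
have wm : w ^+ m = 1.
  rewrite /w expIX// mulrCA [m%:R * _]mulrC divfK//; exact: expI_2pi_natmul.
have := subrX1 w m; rewrite wm subrr => /eqP; rewrite eq_sym.
rewrite -normr_eq0 quat_normM mulf_eq0 !normr_eq0 subr_eq0 (negbTE w1)/=.
by move/eqP.
Qed.

Lemma cos_expI I t : (2 * cos t)%:A = expI I t + expI I (- t).
Proof.
rewrite /expI cosN sinN scaleNr addrACA subrr addr0 -scalerDl.
by congr (_ *: _); lra.
Qed.

Lemma sum_cos_expI I l n m : imag_units I -> (l + n < m)%N ->
  \sum_(k < m) cos (l%:R * root_angle m k) *: expI I (n%:R * root_angle m k) =
  (m%:R / 2 * ((l + n == 0)%N%:R + (n == l)%:R))%:A.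
Proof.
move=> uI lnm.
have -> : \sum_(k < m) cos (l%:R * root_angle m k) *:
      expI I (n%:R * root_angle m k) =
    2^-1 *: (\sum_(k < m) expI I ((l + n)%:R * root_angle m k) +
            \sum_(k < m) expI I ((n%:R - l%:R) * root_angle m k)).
  rewrite -big_split/= scaler_sumr; apply: eq_bigr => k _.
  rewrite natrD !mulrDl mulNr !expID// [expI I (n%:R * _) * _](@in_plane_comm _ I);
    [|exact: expI_in_plane..].
  rewrite -mulrDl -cos_expI -scalerAl mul1r !scalerA mulKf ?pnatr_eq0//.
rewrite sum_roots//; have -> : \sum_(k < m) expI I ((n%:R - l%:R) * root_angle m k)
    = (m%:R * (n == l)%:R)%:A.
  have [ln|nl] := leqP l n.
    under eq_bigr do rewrite -natrB//.
    rewrite sum_roots//; last by rewrite (leq_ltn_trans _ lnm)// leq_subLR addnA leq_addl.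
    by rewrite subn_eq0 eqn_leq ln andbT.
  under eq_bigr do rewrite -opprB -natrB ?(ltnW nl)// mulNr expI_opp.
  rewrite sum_roots//; last by rewrite (leq_ltn_trans _ lnm)// leq_subLR addnCA leq_addr.
    by rewrite subn_eq0 leqNgt nl/= ltn_eqF.
  exact: imag_unitsN.
by rewrite -scalerDl scalerA -mulrDr mulrA [_^-1 * _]mulrC.
Qed.

(** The product of the trigonometric polynomial and of the real part of the
    series has a nonnegative average over the m-th roots of unity. By
    orthogonality this average tends to one half of the expression below as m
    grows, the constant terms being counted twice. *)
Lemma mean_kernel_ge0 I e (z0 : quat R) (kappa : nat -> R) N :
  imag_units I -> slice_plane I z0 -> `|z0| < 1 -> subgeometric e ->
  (forall t, 0 <= qre (psum e (z0 * expI I t))) ->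
  (forall t, 0 <= \sum_(l < N.+1) kappa l * cos (l%:R * t)) ->
  0 <= kappa 0%N * qre (e 0%N) +
       \sum_(l < N.+1) kappa l * qre (z0 ^+ l * e l).
Proof.
move=> uI zI z1 eg pos kpos.
have z01 : 0 <= `|z0| < 1 by rewrite normr_ge0.
have [C [y [y01 C0 Ce]]] := psum_geometric eg z01.
pose S := \sum_(l < N.+1) `|kappa l|.
have KS t : \sum_(l < N.+1) kappa l * cos (l%:R * t) <= S.
  apply: ler_sum => l _; apply: le_trans (ler_norm _) _.
  by rewrite normrM ler_piMr// ler_norml cos_geN1 cos_le1.
apply: (@le_geometric_error _ _ _ (2 * (S * C)) y N.+1) => // M NM.
(* The degrees below M and the frequencies up to N do not interfere modulo m. *)
pose m := (N + M).+1; pose K t := \sum_(l < N.+1) kappa l * cos (l%:R * t).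
pose P q := \sum_(n < M) q ^+ n * e n.
have m0 : 0 < m%:R :> R by rewrite ltr0n.
have avgP : \sum_(k < m) K (root_angle m k) *
      qre (P (z0 * expI I (root_angle m k))) =
    m%:R / 2 * (kappa 0%N * qre (e 0%N) +
       \sum_(l < N.+1) kappa l * qre (z0 ^+ l * e l)).
  have -> : \sum_(k < m) K (root_angle m k) *
        qre (P (z0 * expI I (root_angle m k))) =
      \sum_(l < N.+1) \sum_(n < M) kappa l * qre (z0 ^+ n *
        (\sum_(k < m) cos (l%:R * root_angle m k) *:
           expI I (n%:R * root_angle m k)) * e n).
    under eq_bigr => k _.
      rewrite /K mulr_suml.
      under eq_bigr => l _ do rewrite /P (raddf_sum (@qre R)) mulr_sumr.
      over.
    rewrite exchange_big; apply: eq_bigr => l _.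
    rewrite exchange_big; apply: eq_bigr => n _.
    rewrite mulr_sumr mulr_suml (raddf_sum (@qre R)) mulr_sumr.
    apply: eq_bigr => k _; rewrite -mulrA; congr (_ * _).
    move: (cos _) => c; rewrite -[X in _ = qre (X * _)]scalerAr.
    rewrite -[X in _ = qre X]scalerAl; congr (_ * qre (_ * _)).
    rewrite exprMn_comm ?expIX//.
    by apply: (@in_plane_comm _ I) => //; exact: expI_in_plane.
  have -> : kappa 0%N * qre (e 0%N) = \sum_(l < N.+1)
      (val l == 0%N)%:R * (kappa l * qre (z0 ^+ l * e l)).
    rewrite big_ord_recl/= mul1r expr0 mul1r big1 ?addr0// => i _.
    by rewrite mul0r.
  rewrite -big_split/= mulr_sumr; apply: eq_bigr => l _.
  have lM : (l < M)%N by exact: leq_trans NM.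
  rewrite (bigD1 (Ordinal lM))//= [X in _ + X]big1 => [|n nl]; last first.
    rewrite sum_cos_expI//; last first.
      by rewrite /m ltnS leq_add ?(ltnW (ltn_ord n))// -ltnS.
    rewrite (_ : (n == l :> nat) = false); last by apply: contraNF nl.
    rewrite (_ : (_ == 0)%N = false) ?addr0 ?mulr0 ?scale0r ?mulr0 ?mul0r ?mulr0//.
    apply: contraNF nl; rewrite addn_eq0 => /andP[/eqP l0 /eqP n0].
    by rewrite -val_eqE/= l0 n0.
  rewrite addr0 sum_cos_expI//; last by rewrite /m ltnS leq_add ?(ltnW lM)// -ltnS.
  rewrite eqxx addn_eq0 andbb; set c := m%:R / 2 * _.
  rewrite -[X in qre (X * _)]scalerAr mulr1 -[X in qre X]scalerAl.
  by rewrite qreZ /c /=; ring.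
have : 0 <= \sum_(k < m) K (root_angle m k) *
    (qre (P (z0 * expI I (root_angle m k))) + C * y ^+ M).
  apply: sumr_ge0 => k _; rewrite mulr_ge0 ?kpos//.
  have nz : `|z0 * expI I (root_angle m k)| <= `|z0|.
    by rewrite quat_normM norm_expI// mulr1.
  have [_ /(_ M)] := Ce _ nz; set w := psum _ _ - _ => wC.
  have := pos (root_angle m k); have := le_trans (ler_qre w) wC.
  by rewrite /w /= /P; lra.
under eq_bigr do rewrite mulrDr.
rewrite big_split/= avgP -mulr_suml => ge0.
have le1 : \sum_(k < m) K (root_angle m k) * (C * y ^+ M) <= m%:R * S * (C * y ^+ M).
  rewrite -mulr_suml ler_wpM2r ?mulr_ge0 ?exprn_ge0//.
    by case/andP: y01.
  apply: le_trans (ler_sum _ _) _; first by move=> k _; exact: KS.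
  by rewrite sumr_const card_ord mulr_natl.
rewrite -(@ler_pM2l _ (m%:R / 2)) ?divr_gt0// mulr0 mulrDr.
rewrite -mulr_suml in le1.
apply: le_trans ge0 _; rewrite lerD2l; apply: le_trans le1 _.
by rewrite le_eqVlt; apply/orP; left; apply/eqP; field.
Qed.

End RootsOfUnity.

(** * Power series with nonnegative real part on a slice *)

Section Harnack.
Variables (R : realType) (I : quat R) (e : nat -> quat R) (z0 : quat R).
Hypotheses (uI : imag_units I) (z0I : slice_plane I z0) (z01 : `|z0| < 1).
Hypotheses (eg : subgeometric e).
Hypothesis pos : forall t, 0 <= qre (psum e (z0 * expI I t)).

(** The kernel is 1 + cos (l t). *)
Lemma caratheodory_coef l : (0 < l)%N -> - qre (z0 ^+ l * e l) <= 2 * qre (e 0%N).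
Proof.
move=> l0; have l0' : (l == 0)%N = false by rewrite eqn0Ngt l0.
pose kappa j : R := (j == 0%N)%:R + (j == l)%:R.
have sumk (u : nat -> R) : \sum_(j < l.+1) kappa j * u j = u 0%N + u l.
  under eq_bigr do rewrite mulrDl.
  rewrite big_split/= [X in X + _]big_ord_recl [X in _ + X]big_ord_recr/=.
  rewrite eqxx !mul1r !big1 ?addr0 ?add0r// => i _; last by rewrite mul0r.
  by rewrite ltn_eqF ?mul0r.
have := mean_kernel_ge0 (kappa := kappa) (N := l) uI z0I z01 eg pos.
rewrite (sumk (fun j => qre (z0 ^+ j * e j))) expr0 mul1r => ge0.
have k0 : kappa 0%N = 1 by rewrite /kappa eqxx eq_sym l0' addr0.
move: ge0; rewrite k0 mul1r => ge0; suff : 0 <= qre (e 0%N) + (qre (e 0%N) + qre (z0 ^+ l * e l)).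
  by lra.
apply: ge0 => t; rewrite (sumk (fun j => cos (j%:R * t))) mul0r cos0.
by rewrite -lerBlDl sub0r cos_geN1.
Qed.

(** The partial sums of the Poisson kernel 1 + 2 x cos t + 2 x^2 cos (2 t) + ..,
    multiplied by its denominator. *)
Lemma poisson_kernel (x t : R) N :
  (1 - 2 * x * cos t + x ^+ 2) * (2 * (\sum_(l < N.+1) x ^+ l * cos (l%:R * t)) - 1)
  = 1 - x ^+ 2 - 2 * x ^+ N.+1 * cos (N.+1%:R * t)
    + 2 * x ^+ N.+2 * cos (N%:R * t).
Proof.
elim: N => [|N IHN].
  by rewrite big_ord_recl big_ord0 addr0 expr0 mul0r cos0 !mul1r; ring.
rewrite big_ord_recr/=.
have -> : cos (N.+2%:R * t) = 2 * cos t * cos (N.+1%:R * t) - cos (N%:R * t).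
  have -> : N.+2%:R * t = N.+1%:R * t + t by rewrite -[N.+2]addn1 natrD; ring.
  have -> : N%:R * t = N.+1%:R * t - t by rewrite -[N.+1]addn1 natrD; ring.
  by rewrite cosD cosB; ring.
move: IHN; set S := \sum_(_ < _) _ => IHN.
set b := x ^+ N.+1 * cos _; have -> : 2 * (S + b) - 1 = (2 * S - 1) + 2 * b by ring.
rewrite mulrDr IHN /b !exprS; ring.
Qed.

(** The kernel is a partial sum of the Poisson kernel, shifted down by the
    minimum (1 - x) / (1 + x) of the full kernel. *)
Lemma harnack x : 0 <= x < 1 ->
  (1 - x) / (1 + x) * qre (e 0%N) <= qre (psum e (x *: z0)).
Proof.
move=> x01; have /andP[x0 x1] := x01.
have x1' : 0 < 1 - x by rewrite subr_gt0.
have x1'' : 0 < 1 + x by rewrite ltr_pwDl.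
(* eps N bounds the remainder of the Poisson kernel. *)
pose c := (1 - x) / (1 + x); pose eps N : R := 4 * x ^+ N.+1 / (1 - x) ^+ 2.
have xz1 : 0 <= `|x *: z0| < 1.
  by rewrite normr_ge0 normrZ ger0_norm//= mulr_ilt1.
have [C [y [/andP[y0 y1] C0 /(_ _ (lexx _))[_ Ce]]]] := psum_geometric eg xz1.
have w01 : 0 <= Num.max x y < 1 by rewrite le_max x0 gt_max x1 y1.
apply: (@le_geometric_error _ _ _ (C + 4 / (1 - x) ^+ 2 * `|qre (e 0%N)|)
  (Num.max x y) 0) => // N _.
pose kappa l := 2 * x ^+ l - (l == 0%N)%:R * (1 + c - eps N).
have sumk (u : nat -> R) : \sum_(l < N.+1) kappa l * u l =
    2 * (\sum_(l < N.+1) x ^+ l * u l) - (1 + c - eps N) * u 0%N.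
  under eq_bigr do rewrite mulrBl.
  rewrite sumrB mulr_sumr; congr (_ - _).
    by apply: eq_bigr => l _; rewrite mulrA.
  rewrite big_ord_recl/= mul1r big1 ?addr0// => i _.
  by rewrite !mul0r.
have := mean_kernel_ge0 (kappa := kappa) (N := N) uI z0I z01 eg pos.
rewrite (sumk (fun j => qre (z0 ^+ j * e j))) expr0 mul1r => ge0.
have {ge0} : 0 <= kappa 0%N * qre (e 0%N) + (2 *
    (\sum_(l < N.+1) x ^+ l * qre (z0 ^+ l * e l))
    - (1 + c - eps N) * qre (e 0%N)).
  apply: ge0 => t; rewrite (sumk (fun j => cos (j%:R * t))) mul0r cos0 mulr1.
  have := poisson_kernel x t N; set S := \sum_(_ < _) _.
  set D := 1 - _ + _ => DS.
  have := cos_le1 t; have := cos_geN1 t => ct1 ct2.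
  have Dge : (1 - x) ^+ 2 <= D by rewrite /D; nra.
  have Dle : D <= (1 + x) ^+ 2 by rewrite /D; nra.
  have D0 : 0 < D by apply: lt_le_trans Dge; rewrite exprn_gt0.
  suff : c - eps N <= 2 * S - 1 by lra.
  have xN : 0 <= x ^+ N.+1 by rewrite exprn_ge0.
  have num : 1 - x ^+ 2 - 4 * x ^+ N.+1 <= D * (2 * S - 1).
    rewrite DS [x ^+ N.+2]exprSr; have := cos_le1 (N.+1%:R * t).
    have := cos_geN1 (N%:R * t); set cN := cos _; set cN1 := cos _ => h1 h2.
    have xN1 : x ^+ N.+1 * x <= x ^+ N.+1 by rewrite ler_piMr// ltW.
    have xN2 : 0 <= x ^+ N.+1 * x by rewrite mulr_ge0.
    have e1 : x ^+ N.+1 * cN1 <= x ^+ N.+1 by rewrite ler_piMr.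
    have e2 : - (x ^+ N.+1 * x) <= x ^+ N.+1 * x * cN.
      by rewrite -mulrN1 ler_wpM2l.
    rewrite -[2 * x ^+ N.+1 * cN1]mulrA -[2 * (x ^+ N.+1 * x) * cN]mulrA.
    by lra.
  have cD : D * c <= 1 - x ^+ 2.
    rewrite /c mulrA ler_pdivrMr// mulrC.
    have -> : (1 - x ^+ 2) * (1 + x) = (1 - x) * (1 + x) ^+ 2 by ring.
    by rewrite ler_pM2l.
  have eD : 4 * x ^+ N.+1 <= D * eps N.
    rewrite /eps mulrA ler_pdivlMr ?exprn_gt0// [leRHS]mulrC.
    by rewrite ler_wpM2l// mulr_ge0.
  by rewrite -(ler_pM2l D0) mulrBr; lra.
rewrite /kappa eqxx expr0 mulr1 mul1r => ge0.
have partial : \sum_(l < N.+1) x ^+ l * qre (z0 ^+ l * e l) <=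
    qre (psum e (x *: z0)) + C * y ^+ N.+1.
  rewrite -lerBlDl; apply: le_trans (Ce N.+1).
  rewrite -normrN opprB; apply: le_trans (ler_qre _).
  rewrite raddfB/= lerD2r (raddf_sum (@qre R)); apply: ler_sum => l _.
  by rewrite exprZn -scalerAl.
have yw : C * y ^+ N.+1 <= C * Num.max x y ^+ N.
  rewrite ler_wpM2l// exprS; apply: le_trans (ler_piMl _ (ltW y1)) _.
    by rewrite exprn_ge0.
  by rewrite lerXn2r ?nnegrE ?le_max ?x0 ?lexx ?orbT.
have ew : eps N * qre (e 0%N) <=
    4 / (1 - x) ^+ 2 * `|qre (e 0%N)| * Num.max x y ^+ N.
  have -> : eps N * qre (e 0%N) = 4 / (1 - x) ^+ 2 * qre (e 0%N) * x ^+ N.+1.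
    by rewrite /eps; ring.
  have d0 : 0 <= 4 / (1 - x) ^+ 2 by rewrite divr_ge0// exprn_ge0// ltW.
  apply: (@le_trans _ _ (4 / (1 - x) ^+ 2 * `|qre (e 0%N)| * x ^+ N.+1)).
    by rewrite ler_wpM2r ?exprn_ge0// ler_wpM2l// ler_norm.
  rewrite ler_wpM2l//; first by rewrite mulr_ge0.
  rewrite exprS; apply: le_trans (ler_piMl _ (ltW x1)) _.
    by rewrite exprn_ge0.
  by rewrite lerXn2r ?nnegrE ?le_max ?x0 ?lexx ?orbT.
rewrite [(C + _) * _]mulrDl -/c; lra.
Qed.

End Harnack.

(** * Uniform linear approximation of a slice regular function *)

Section LinearApproximation.
Variable R : realType.
Implicit Types (f g : quat R -> quat R) (I p q u v c : quat R).

Lemma qreMr_continuous u : continuous (fun q : quat R => qre (q * u)).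
Proof.
move=> q; apply/(@cvgrPdist_lt _ _ _ (nbhs q) (nbhs_filter q)) => e e0.
have u1 : 0 < `|u| + 1 by rewrite ltr_wpDl.
apply/nbhs_ballP; exists (e / (`|u| + 1)); rewrite /= ?divr_gt0// => p qp.
have {}qp : `|q - p| < e / (`|u| + 1) by [].
rewrite -qreB -mulrBl; apply: le_lt_trans (ler_abs_qre _) _.
rewrite quat_normM; apply: (@le_lt_trans _ _ (`|q - p| * (`|u| + 1))).
  by rewrite ler_wpM2l// lerDl.
by rewrite -ltr_pdivlMr.
Qed.

Lemma qre_is_derive g p v u (t : R) : derivable g (p + t *: v) v ->
  is_derive t 1 (fun s : R => qre (g (p + s *: v) * u))
    (qre ('D_v g (p + t *: v) * u)).
Proof.
move=> dg.
have cvq : h^-1 *: ((fun s : R => qre (g (p + s *: v) * u)) (h *: 1 + t) -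
    qre (g (p + t *: v) * u)) @[h --> 0^'] --> qre ('D_v g (p + t *: v) * u).
  rewrite (_ : (fun h : R => _) = (fun q : quat R => qre (q * u)) \o
      (fun h : R => h^-1 *: (g (h *: v + (p + t *: v)) - g (p + t *: v)))).
    by apply: continuous_cvg; [exact: qreMr_continuous|exact: dg].
  apply/funext => h; rewrite -[RHS]/(qre (h^-1 *: (_ - _) * u)).
  rewrite -scalerAl qreZ mulrBl qreB [h *: 1]mulr1.
  by rewrite [h *: v + _]addrCA -scalerDl.
by split; [exact: cvgP cvq|exact: cvg_lim cvq].
Qed.

(** The real mean value theorem, applied in each direction u. *)
Lemma mean_value_right g p v c (e T : R) : 0 <= T ->
  (forall t, 0 <= t <= T -> derivable g (p + t *: v) v /\
     `|'D_v g (p + t *: v) - c| <= e) ->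
  `|g (p + T *: v) - g p - T *: c| <= e * T.
Proof.
move=> T0 dg; apply: quat_norm_le_qre => u u1.
pose phi s := qre (g (p + s *: v) * u).
have dphi t : 0 <= t <= T -> is_derive t 1 phi (qre ('D_v g (p + t *: v) * u)).
  by move=> /dg[dt _]; exact: qre_is_derive.
have [||t] := @MVT_segment _ phi (fun t => qre ('D_v g (p + t *: v) * u)) 0 T T0.
- move=> t; rewrite in_itv/= => /andP[t0 tT]; apply: dphi.
  by rewrite !ltW.
- apply: derivable_within_continuous => t; rewrite in_itv/= => tT.
  exact: (@ex_derive _ _ _ _ _ _ _ (dphi t tT)).
rewrite in_itv/= /phi scale0r addr0 subr0 => tT.
rewrite -qreB -mulrBl => phiE.
rewrite mulrBl qreB phiE -scalerAl qreZ mulrC -mulrBr -qreB -mulrBl.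
rewrite mulrC ler_wpM2r//; apply: le_trans (ler_qre _) _.
by rewrite quat_normM u1 mulr1; have [] := dg t tT.
Qed.

Lemma mean_value g p v c (e T : R) :
  (forall t, `|t| <= `|T| -> derivable g (p + t *: v) v /\
     `|'D_v g (p + t *: v) - c| <= e) ->
  `|g (p + T *: v) - g p - T *: c| <= e * `|T|.
Proof.
move=> dg; have [T0|T0] := leP 0 T.
  rewrite [X in e * X](ger0_norm T0); apply: mean_value_right => // t /andP[t0 tT].
  by apply: dg; rewrite !ger0_norm.
rewrite [X in e * X](ltr0_norm T0) -normrN.
have -> : - (g (p + T *: v) - g p - T *: c) =
    g ((p + T *: v) + - T *: v) - g (p + T *: v) - - T *: c.
  by rewrite scaleNr addrK scaleNr !opprB opprK [LHS]addrC -addrA [RHS]addrC addrC.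
apply: mean_value_right => [|t /andP[t0 tT]]; first by rewrite oppr_ge0 ltW.
rewrite -addrA -scalerDl; apply: dg.
rewrite (ltr0_norm T0) ler_norml; apply/andP; split; lra.
Qed.

Section Slice.
Variables (I : quat R) (f : quat R -> quat R).
Hypotheses (uI : imag_units I) (fr : slice_regular f).
Let F := 'D_1 f.

(** Multiply the Cauchy-Riemann equation by I on the left. *)
Lemma slice_regular_DI q : slice_ball I q -> 'D_I f q = I * F q.
Proof.
have [_ _ _ cr] := fr uI; move=> /cr /eqP; rewrite scaler_eq0 invr_eq0.
rewrite pnatr_eq0/= addr_eq0 => /eqP DE.
by rewrite /F DE mulrN mulrA (imag_unit_sqr uI) mulN1r opprK.
Qed.

Lemma expI_continuous : continuous (expI I).
Proof.
move=> t; rewrite (_ : expI I = (fun s => cos s *: 1) + (fun s => sin s *: I))//.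
apply: (@cvgD _ _ _ (nbhs t) (nbhs_filter t)); apply: cvgZr_tmp.
  exact: continuous_cos.
exact: continuous_sin.
Qed.

Lemma compact_slice_cball r : compact (slice_cball I r).
Proof.
pose polar (st : R * R) := st.1 *: expI I st.2.
suff -> : slice_cball I r = polar @` (`[0, r] `*` `[- pi, pi]).
  apply: continuous_compact; last first.
    by apply: compact_setX; exact: segment_compact.
  apply: continuous_subspaceT => st; apply: cvgZ; first exact: cvg_fst.
  apply: (@continuous_comp _ _ _ (fun x : R * R => x.2) (expI I)).
    exact: cvg_snd.
  exact: expI_continuous.
apply/seteqP; split => q /=.
  move=> [qr /(plane_polar uI)[t tpi ->]]; exists (`|q|, t) => //=.
  by rewrite !in_itv/= normr_ge0 qr; split => //; rewrite -ler_norml.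
move=> [[s t] /=]; rewrite !in_itv/= => -[/andP[s0 sr] _] <-; split.
  by rewrite /polar/= normrZ norm_expI// mulr1 ger0_norm.
by apply: in_planeZ; exact: expI_in_plane.
Qed.

(** Heine and Cantor's argument, with q in a compact disc and q' in the whole
    slice of the ball. *)
Lemma slice_derivative_unif_continuous r e : r < 1 -> 0 < e ->
  exists2 d, 0 < d & forall q q', slice_cball I r q -> slice_ball I q' ->
    `|q' - q| < d -> `|F q' - F q| <= e.
Proof.
move=> r1 e0; have [_ cF _ _] := fr uI.
have /compact_near_coveringP ncov := @compact_slice_cball r.
pose P d q := slice_ball I q -> forall q', slice_ball I q' ->
  `|q' - q| < d -> `|F q' - F q| <= e.
have KB : slice_cball I r `<=` slice_ball I.
  by move=> q [qr qI]; split => //; exact: le_lt_trans r1.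
have ptw q : slice_cball I r q -> \forall q' \near q & d \near 0^'+, P d q'.
  move=> /KB qB; move/subspace_continuousP : cF => /(_ q qB).
  have e2 : 0 < e / 2 by rewrite divr_gt0.
  move=> /(@cvgrPdist_lt _ _ _ (within (slice_ball I) (nbhs q))
    (within_filter _ (nbhs_filter q))) /(_ _ e2) /nbhs_ballP[d /= d0 dq].
  have d2 : 0 < d / 2 by rewrite divr_gt0.
  exists (ball q (d / 2), [set d' | d' < d / 2]) => /=.
    by split; [exact: nbhsx_ballx|exact: nbhs_right_lt].
  move=> [p d'] /= [qp d'd] pB q' q'B q'p.
  have {}qp : `|q - p| < d / 2 by [].
  have Fp : `|F q - F p| < e / 2.
    by apply: dq => //; rewrite -ball_normE/=; apply: lt_trans qp _; lra.
  have Fq' : `|F q - F q'| < e / 2.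
    apply: dq => //; rewrite -ball_normE/=.
    rewrite -(subrK p q) -addrA; apply: le_lt_trans (ler_normD _ _) _.
    by move: q'p; rewrite distrC; lra.
  rewrite -(subrK (F q) (F q')) -addrA; apply: le_trans (ler_normD _ _) _.
  by rewrite distrC; lra.
have := ncov _ (0^'+) P _ ptw; move=> nearP.
have [d [d0 dP]] : exists d, 0 < d /\ slice_cball I r `<=` P d.
  have : \forall d \near 0^'+, 0 < d /\ slice_cball I r `<=` P d.
    apply: filterI; last exact: nearP.
    exact: nbhs_right_gt.
  by move=> /filter_ex[d dP]; exists d.
by exists d => // q q' qK q'B; apply: dP => //; exact: KB.
Qed.

Lemma slice_derivative_bounded r : r < 1 ->
  exists2 B, 0 <= B & forall q, slice_cball I r q -> `|F q| <= B.
Proof.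
move=> r1; have [_ cF _ _] := fr uI.
have KB : slice_cball I r `<=` slice_ball I.
  by move=> q [qr qI]; split => //; exact: le_lt_trans r1.
have := continuous_compact (continuous_subspaceW KB cF) (@compact_slice_cball r).
move=> /compact_bounded[B [Br BF]].
exists (`|B| + 1) => [|q qK]; first by rewrite addr_ge0.
apply: BF; last by exists q.
by rewrite (le_lt_trans (ler_norm _))// ltrDl.
Qed.

(** Go first along the real direction, then along I. By the Cauchy-Riemann
    equation the increments of both steps multiply the slice derivative on the
    left, and its uniform continuity makes the error uniform in q. *)
Lemma slice_linear_approx r e : r < 1 -> 0 < e ->
  exists2 d, 0 < d & forall q q', slice_cball I r q -> slice_plane I q' ->
    `|q' - q| < d -> `|f q' - f q - (q' - q) * F q| <= e * `|q' - q|.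
Proof.
move=> r1 e0; have e2 : 0 < e / 2 by rewrite divr_gt0.
have [d0 d00 dF] := slice_derivative_unif_continuous r1 e2.
exists (Num.min d0 (1 - r) / 2).
  by rewrite divr_gt0// lt_min d00 subr_gt0.
move=> q q' qK [x' [y' q'E]] q'q; have [/= qr [x [y qE]]] := qK.
pose s := x' - x; pose t := y' - y; pose dlt := `|q' - q|.
have dE : q' - q = s%:A + t *: I.
  by rewrite q'E qE opprD addrACA -!scalerBl.
have q'E' : q' = (q + s *: 1) + t *: I by rewrite -addrA -dE addrC subrK.
have d2E : dlt ^+ 2 = s ^+ 2 + t ^+ 2 by rewrite /dlt dE in_plane_sqnorm.
have dlt0 : 0 <= dlt by exact: normr_ge0.
have sd : `|s| <= dlt.
  by rewrite -(@ler_pXn2r _ 2) ?nnegrE// real_normK ?num_real// d2E lerDl sqr_ge0.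
have td : `|t| <= dlt.
  by rewrite -(@ler_pXn2r _ 2) ?nnegrE// real_normK ?num_real// d2E lerDr sqr_ge0.
have near_q a b : `|a| <= `|s| -> `|b| <= `|t| ->
    slice_ball I (q + a *: 1 + b *: I) /\ `|F (q + a *: 1 + b *: I) - F q| <= e / 2.
  move=> sa tb; set p := _ + _.
  have pq : `|p - q| < Num.min d0 (1 - r).
    rewrite /p -[q + _ + _]addrA [q + _]addrC addrK; apply: le_lt_trans (ler_normD _ _) _.
    have [_ nI] := (imag_unitP I).1 uI; rewrite !normrZ nI quat_norm1 !mulr1.
    by move: q'q; rewrite ltr_pdivlMr// -/dlt; lra.
  move: pq; rewrite lt_min => /andP[pd pr].
  have pB : slice_ball I p.
    split.
      rewrite /qball/= -(subrK q p); apply: le_lt_trans (ler_normD _ _) _.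
      by lra.
    by rewrite /p qE; exists (x + a), (y + b); rewrite !scalerDl -!addrA; congr (_ + _); rewrite addrCA.
  by split => //; exact: dF.
have nI : `|I| = 1 by have [] := (imag_unitP I).1 uI.
have step1 : `|f (q + s *: 1) - f q - s *: F q| <= e / 2 * `|s|.
  apply: mean_value => a sa; have [||pB pF] := near_q a 0; rewrite ?normr0//.
  rewrite scale0r addr0 in pB pF; split => //.
  by have [/(_ _ pB)[]] := fr uI.
have step2 : `|f q' - f (q + s *: 1) - t *: (I * F q)| <= e / 2 * `|t|.
  rewrite q'E'; apply: mean_value => b tb; have [||pB pF] := near_q s b; rewrite //.
  split; first by have [/(_ _ pB)[]] := fr uI.
  by rewrite slice_regular_DI// -mulrBr quat_normM nI mul1r.
rewrite dE mulrDl -!scalerAl mul1r.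
have -> : f q' - f q - (s *: F q + t *: (I * F q)) =
    (f q' - f (q + s *: 1) - t *: (I * F q)) + (f (q + s *: 1) - f q - s *: F q).
  move: (s *: _) (t *: _) (f _) (f (q + _)) (f _) => S T X Y Z.
  by rewrite opprD -!addrA [- T + (Y + _)]addrCA addKr [- T + _]addrC -!addrA.
apply: le_trans (ler_normD _ _) _; apply: le_trans (lerD step2 step1) _.
rewrite -dE -/dlt -mulrDr mulrAC ler_pdivrMr// -mulrA ler_pM2l//.
by lra.
Qed.

End Slice.

End LinearApproximation.

(** * Cauchy's formula by averages over roots of unity *)

Section Lipschitz.
Variable R : realType.
Implicit Types (I : quat R).

Lemma expI_lipschitz I (s t : R) : imag_units I ->
  `|expI I s - expI I t| <= 2 * `|s - t|.
Proof.
move=> uI; wlog st : s t / t <= s.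
  move=> wlg; have [|/ltW] := leP t s; first exact: wlg.
  by rewrite distrC [X in _ * X]distrC; exact: wlg.
have lip (h dh : R -> R) : (forall x : R, is_derive x (1 : R) h (dh x)) ->
    (forall x, `|dh x| <= 1) -> `|h s - h t| <= `|s - t|.
  move=> hd dh1; have [|c _ ->] := @MVT_segment _ h dh t s st (fun x _ => hd x).
    apply: derivable_within_continuous => x _.
    exact: (@ex_derive _ _ _ _ _ _ _ (hd x)).
  by rewrite normrM ler_piMl.
have nI : `|I| = 1 by have [] := (imag_unitP I).1 uI.
rewrite /expI opprD addrACA -!scalerBl; apply: le_trans (ler_normD _ _) _.
rewrite !normrZ nI quat_norm1 !mulr1 mulr_natl mulr2n lerD//.
  apply: (@lip _ (fun x => - sin x)) => x.
  by rewrite normrN ler_norml sin_geN1 sin_le1.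
apply: (@lip _ cos) => x; by rewrite ler_norml cos_geN1 cos_le1.
Qed.

Lemma sum_even_odd (V : nmodType) (h : nat -> V) m :
  \sum_(k < m.*2) h k = \sum_(k < m) (h k.*2 + h k.*2.+1).
Proof.
elim: m => [|m IHm]; first by rewrite !big_ord0.
by rewrite doubleS !big_ord_recr/= IHm addrA.
Qed.

Lemma root_angle_double m k : (0 < m)%N ->
  root_angle R m.*2 k.*2 = root_angle R m k.
Proof.
move=> m0; have : m%:R != 0 :> R by rewrite pnatr_eq0 -lt0n.
by rewrite /root_angle -!muln2 !natrM => ?; field.
Qed.

(** Halving the mesh of the 2^s-th roots of unity puts each new node at distance
    pi / 2^s from an old one, so that successive averages differ by a geometric
    term. *)
Lemma mean_lipschitz_cvg (G : R -> quat R) (D : R) :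
  (forall s t, `|G s - G t| <= D * `|s - t|) ->
  exists l C, forall s, `|l - (2 ^+ s)^-1 *:
    \sum_(k < (2 ^ s)%N) G (root_angle R (2 ^ s)%N k)| <= C * 2^-1 ^+ s.
Proof.
move=> GD; pose M s := (2 ^+ s)^-1 *:
  \sum_(k < (2 ^ s)%N) G (root_angle R (2 ^ s)%N k).
have D0 : 0 <= D.
  by have := GD 1 0; rewrite subr0 normr1 mulr1; exact: le_trans.
have MD s : `|M s.+1 - M s| <= (D * pi / 2) * 2^-1 ^+ s.
  have p0 : 0 < 2 ^+ s :> R by rewrite exprn_gt0.
  have -> : M s.+1 - M s = (2 ^+ s.+1)^-1 *: \sum_(k < (2 ^ s)%N)
      (G (root_angle R (2 ^ s.+1)%N k.*2.+1) - G (root_angle R (2 ^ s.+1)%N k.*2)).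
    rewrite /M expnS mul2n.
    rewrite (sum_even_odd (fun k => G (root_angle R (2 ^ s).*2%N k))).
    have -> : \sum_(k < (2 ^ s)%N) G (root_angle R (2 ^ s)%N k) =
        \sum_(k < (2 ^ s)%N) G (root_angle R (2 ^ s).*2%N k.*2).
      by apply: eq_bigr => k _; rewrite root_angle_double// expn_gt0.
    rewrite !sumrB big_split/=; move: (\sum_(_ < _) _) (\sum_(_ < _) _) => T S.
    have -> : (2 ^+ s)^-1 = (2 ^+ s.+1)^-1 * 2 :> R.
      by rewrite exprS; field; rewrite gt_eqF.
    rewrite -scalerA -scalerBr; congr (_ *: _).
    by rewrite scaler_nat mulr2n opprD addrA [S + T]addrC addrK.
  rewrite normrZ ger0_norm ?invr_ge0 ?exprn_ge0//.
  rewrite -(ler_pM2l (_ : 0 < 2 ^+ s.+1)) ?exprn_gt0// mulrA divff ?mul1r; last first.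
    by rewrite gt_eqF// exprn_gt0.
  apply: le_trans (ler_norm_sum _ _ _) _.
  apply: (@le_trans _ _ (\sum_(k < (2 ^ s)%N) D * (pi / 2 ^+ s))).
    apply: ler_sum => k _; apply: le_trans (GD _ _) _; rewrite ler_wpM2l//.
    rewrite /root_angle -mulrBl -natrB// subSnn mul1r natrX.
    rewrite (_ : _ / _ = pi / 2 ^+ s); last first.
      by rewrite exprS; field; rewrite gt_eqF.
    by rewrite ger0_norm// divr_ge0 ?pi_ge0// exprn_ge0.
  rewrite sumr_const card_ord -[_ *+ (2 ^ s)%N]mulr_natl natrX exprS exprVn.
  by rewrite le_eqVlt; apply/orP; left; apply/eqP; field; rewrite gt_eqF.
have h01 : 0 <= (2^-1 : R) < 1 by rewrite invr_ge0 ler0n/= invf_lt1// ltr1n.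
have [_ tail] := geometric_tail h01 MD.
exists (limn (series (fun n => M n.+1 - M n)) + M 0%N), (D * pi / 2 / (1 - 2^-1)).
move=> s; have := tail s; rewrite -/(M s) -(big_mkord xpredT (fun n => M n.+1 - M n)).
by rewrite telescope_sumr// opprB addrA.
Qed.

End Lipschitz.

Section CauchyFormula.
Variables (R : realType) (I : quat R) (f : quat R -> quat R) (r : R).
Hypotheses (uI : imag_units I) (fr : slice_regular f) (r01 : 0 < r < 1).
Let F := 'D_1 f.

Let r0 : 0 < r. Proof. by case/andP: r01. Qed.
Let r1 : r < 1. Proof. by case/andP: r01. Qed.

Definition circle_point t : quat R := r *: expI I t.

Lemma circle_point_norm t : `|circle_point t| = r.
Proof. by rewrite normrZ norm_expI// mulr1 gtr0_norm. Qed.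

Lemma circle_point_in t : slice_cball I r (circle_point t).
Proof.
split; first by rewrite /= circle_point_norm.
by apply: in_planeZ; exact: expI_in_plane.
Qed.

Lemma slice_cball_convex q q' (l : R) : slice_cball I r q ->
  slice_cball I r q' -> 0 <= l <= 1 -> slice_cball I r (q + l *: (q' - q)).
Proof.
move=> [qr qI] [q'r q'I] /andP[l0 l1]; split; last first.
  by apply: in_planeD => //; apply: in_planeZ; exact: in_planeB.
have -> : q + l *: (q' - q) = (1 - l) *: q + l *: q'.
  by rewrite scalerBr scalerBl scale1r addrA addrAC.
have l1' : 0 <= 1 - l by rewrite subr_ge0.
rewrite /=; apply: le_trans (ler_normD _ _) _; rewrite !normrZ !ger0_norm//.
have := ler_wpM2l l0 q'r; have := ler_wpM2l l1' qr => /=.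
by lra.
Qed.

Lemma subdivision (V : zmodType) (h : R -> V) n : (0 < n)%N ->
  h 1 - h 0 = \sum_(i < n) (h (i.+1%:R / n%:R) - h (i%:R / n%:R)).
Proof.
move=> n0; rewrite -(big_mkord xpredT (fun i => h (i.+1%:R / n%:R) - h (i%:R / n%:R))).
rewrite (@telescope_sumr _ 0 n (fun i => h (i%:R / n%:R)))// mul0r divff//.
by rewrite pnatr_eq0 -lt0n.
Qed.

Lemma subdivision_in01 n i : (i < n)%N ->
  0 <= (i.+1%:R / n%:R : R) <= 1 /\ 0 <= (i%:R / n%:R : R) <= 1.
Proof.
move=> i_n; have n0 : 0 < n%:R :> R by rewrite ltr0n (leq_ltn_trans _ i_n).
by split; rewrite divr_ge0//= ler_pdivrMr// mul1r ler_nat// ltnW.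
Qed.

Lemma slice_lipschitz : exists2 L, 0 <= L & forall q q', slice_cball I r q ->
  slice_cball I r q' -> `|f q' - f q| <= L * `|q' - q|.
Proof.
have [d d0 lin] := slice_linear_approx uI fr r1 ltr01.
have [B B0 FB] := slice_derivative_bounded uI fr r1.
exists (1 + B); first by rewrite addr_ge0.
move=> q q' qK q'K; pose n := Num.bound (`|q' - q| / d).
have qn : `|q' - q| / d < n%:R by apply: archi_boundP; rewrite divr_ge0// ltW.
have n0 : 0 < n%:R :> R by apply: le_lt_trans qn; rewrite divr_ge0// ltW.
pose h (l : R) := f (q + l *: (q' - q)).
have -> : f q' - f q = h 1 - h 0.
  by rewrite /h scale1r scale0r addr0 [q + _]addrC subrK.
rewrite (subdivision h (_ : 0 < n)%N); last by rewrite -(ltr0n R).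
apply: le_trans (ler_norm_sum _ _ _) _.
have -> : (1 + B) * `|q' - q| = \sum_(i < n) ((1 + B) * `|q' - q| / n%:R).
  by rewrite sumr_const card_ord -[_ *+ n]mulr_natr divfK// gt_eqF.
apply: ler_sum => i _; have [i1 i0] := subdivision_in01 (ltn_ord i).
have := slice_cball_convex qK q'K i0; have := slice_cball_convex qK q'K i1.
rewrite /h; set p' := q + i.+1%:R / _ *: _; set p := q + _ *: _ => p'K pK.
have pp' : p' - p = n%:R^-1 *: (q' - q).
  rewrite /p /p' opprD addrACA subrr add0r -scalerBl -mulrBl -natrB//.
  by rewrite subSnn mul1r.
have np : `|p' - p| = `|q' - q| / n%:R.
  by rewrite pp' normrZ ger0_norm ?invr_ge0 ?ler0n// mulrC.
have [_ p'I] := p'K; have := lin p p' pK p'I.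
rewrite mul1r np ltr_pdivrMr// -ltr_pdivrMl// [_ * `|_|]mulrC => /(_ qn) lin_p.
rewrite -(subrK ((p' - p) * F p) (f p' - f p)); apply: le_trans (ler_normD _ _) _.
have -> : (1 + B) * `|q' - q| / n%:R =
  `|q' - q| / n%:R + `|q' - q| / n%:R * B by ring.
by rewrite lerD// quat_normM np ler_wpM2l ?divr_ge0// FB.
Qed.

(** Averaging the linear approximation between consecutive roots of unity on a
    circle, the increments telescope to 0: the mean of the derivative times the
    position tends to 0. This is Cauchy's theorem for the derivative. *)
Lemma derivative_mean_small e d z (l : R) m : 0 < e ->
  (forall q q', slice_cball I r q -> slice_plane I q' ->
    `|q' - q| < d -> `|f q' - f q - (q' - q) * F q| <= e * `|q' - q|) ->
  slice_cball I r z -> 0 < l <= 1 -> (1 < m)%N -> 4 * pi / m%:R < d ->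
  `|\sum_(k < m) circle_point (root_angle R m k) *
     F (z + l *: (circle_point (root_angle R m k) - z))| <= m%:R * (e * r).
Proof.
move=> e0 lin zK /andP[l0 l1] m1 md.
have m0 : 0 < m%:R :> R by rewrite ltr0n (ltn_trans _ m1).
pose zeta k := circle_point (root_angle R m k).
pose p k := z + l *: (zeta k - z); pose w := expI I (pi *+ 2 / m%:R).
have pK k : slice_cball I r (p k).
  by apply: slice_cball_convex => //; [exact: circle_point_in|rewrite ltW].
have zetaS k : zeta k.+1 = w * zeta k.
  rewrite /zeta /circle_point -scalerAr -expID// /root_angle -natr1.
  by rewrite mulrDl mul1r addrC.
have pS k : p k.+1 - p k = l *: ((w - 1) * zeta k).
  rewrite /p opprD addrACA subrr add0r -scalerBr opprB addrA subrK zetaS.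
  by rewrite mulrBl mul1r.
have w1 : `|w - 1| != 0.
  rewrite normr_eq0 subr_eq0; apply: expI_neq1 => //.
  have pi2 : 0 < pi *+ 2 :> R by rewrite mulrn_wgt0// pi_gt0.
  by rewrite divr_gt0//= ltr_pdivrMr// ltr_pMr// ltr1n.
have w1' : 0 < `|w - 1| by rewrite lt_def w1 normr_ge0.
have nz k : `|zeta k| = r by exact: circle_point_norm.
have npS k : `|p k.+1 - p k| = l * `|w - 1| * r.
  by rewrite pS normrZ (gtr0_norm l0) quat_normM nz mulrA.
have npd k : `|p k.+1 - p k| < d.
  apply: le_lt_trans md; rewrite npS.
  apply: (@le_trans _ _ `|w - 1|).
    rewrite -mulrA [_ * r]mulrC mulrA ler_piMl//.
    exact: mulr_ile1 (ltW l0) (ltW r0) l1 (ltW r1).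
  rewrite /w -(expI0 I); apply: le_trans (expI_lipschitz _ _ uI) _.
  rewrite subr0 ger0_norm; last by rewrite divr_ge0// mulrn_wge0// pi_ge0.
  by rewrite mulrA ler_pM2r ?invr_gt0// -[pi *+ 2]mulr_natl mulrA -natrM.
have closed : p m = p 0%N.
  rewrite /p /zeta /root_angle mul0r mulrC divfK ?gt_eqF//.
  by rewrite /circle_point expI0 -[pi *+ 2]add0r expI2pi expI0.
have tel : \sum_(k < m) (f (p k.+1) - f (p k)) = 0.
  rewrite -(big_mkord xpredT (fun k => f (p k.+1) - f (p k))).
  by rewrite (@telescope_sumr _ 0 m (fun k => f (p k)))// closed subrr.
have sumE : (l *: (w - 1)) * \sum_(k < m) zeta k * F (p k) =
    - \sum_(k < m) (f (p k.+1) - f (p k) - (p k.+1 - p k) * F (p k)).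
  rewrite sumrB tel sub0r opprK mulr_sumr; apply: eq_bigr => k _.
  by rewrite pS -[LHS]scalerAl -[RHS]scalerAl mulrA.
have lw : 0 < l * `|w - 1| by rewrite mulr_gt0.
rewrite -(ler_pM2l lw).
have -> : l * `|w - 1| = `|l *: (w - 1)| by rewrite normrZ gtr0_norm.
rewrite -quat_normM sumE normrN normrZ gtr0_norm//.
apply: le_trans (ler_norm_sum _ _ _) _.
apply: (@le_trans _ _ (\sum_(k < m) e * (l * `|w - 1| * r))).
  by apply: ler_sum => k _; rewrite -(npS k); apply: lin => //; have [] := pK k.+1.
rewrite sumr_const card_ord -[_ *+ m]mulr_natl.
by rewrite le_eqVlt; apply/orP; left; apply/eqP; ring.
Qed.

End CauchyFormula.

Section PowerSeries.
Variables (R : realType) (I : quat R) (f : quat R -> quat R) (r : R).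
Hypotheses (uI : imag_units I) (fr : slice_regular f) (r01 : 0 < r < 1).
Let F := 'D_1 f.

Let r0 : 0 < r. Proof. by case/andP: r01. Qed.
Let r1 : r < 1. Proof. by case/andP: r01. Qed.

Section Point.
Variable z : quat R.
Hypotheses (zI : slice_plane I z) (zr : `|z| < r).

Let x := `|z| / r.
Let x01 : 0 <= x < 1.
Proof. by rewrite /x divr_ge0 ?(ltW r0)//= ltr_pdivrMr// mul1r. Qed.
Let x1 : 0 < 1 - x. Proof. by rewrite subr_gt0; case/andP: x01. Qed.

(** The quotient of z by [circle_point I r t], so that Cauchy's kernel is
    1 / (1 - ratio). *)
Definition ratio t : quat R := z * (r^-1 *: expI I (- t)).

Lemma ratio_norm t : `|ratio t| = x.
Proof.
by rewrite quat_normM normrZ norm_expI// mulr1 gtr0_norm// invr_gt0.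
Qed.

Lemma norm_1Bratio t : 1 - x <= `|1 - ratio t|.
Proof. by rewrite -(ratio_norm t) -(quat_norm1 R) lerB_dist. Qed.

Lemma unit_1Bratio t : 1 - ratio t \is a GRing.unit.
Proof.
by rewrite quat_unitE -normr_gt0 (lt_le_trans _ (norm_1Bratio t)).
Qed.

Lemma norm_kernel t : `|(1 - ratio t)^-1| <= (1 - x)^-1.
Proof.
by rewrite quat_normV lef_pV2 ?posrE ?norm_1Bratio// (lt_le_trans _ (norm_1Bratio t)).
Qed.

Lemma kernelE t :
  (1 - ratio t)^-1 * (circle_point I r t - z) = circle_point I r t.
Proof.
suff -> : circle_point I r t - z = (1 - ratio t) * circle_point I r t.
  by rewrite mulKr// unit_1Bratio.
rewrite mulrBl mul1r; congr (_ - _); rewrite /ratio /circle_point.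
rewrite -mulrA -[_ *: _ * _]scalerAl -[_ * (r *: _)]scalerAr scalerA.
rewrite mulVf ?gt_eqF// scale1r.
by rewrite -expID// addNr expI0 mulr1.
Qed.

Lemma kernel_expansion t N : (1 - ratio t)^-1 =
  \sum_(n < N) ratio t ^+ n + (1 - ratio t)^-1 * ratio t ^+ N.
Proof.
apply: (mulrI (unit_1Bratio t)); rewrite mulrDr mulrA divrr ?unit_1Bratio//.
rewrite mul1r; have := subrX1 (ratio t) N.
rewrite -[ratio t - 1]opprB mulNr => /eqP; rewrite -eqr_oppLR opprB => /eqP <-.
by rewrite subrK.
Qed.

(** Cauchy's formula at z: the mean of the kernel times the increments of [f]
    vanishes in the limit. The segments from z to the circle are subdivided;
    on each step the linear approximation leaves the mean of the derivative. *)
Lemma cauchy_mean_small e : 0 < e -> exists m0, forall m, (m0 <= m)%N ->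
  `|\sum_(k < m) (1 - ratio (root_angle R m k))^-1 *
     (f (circle_point I r (root_angle R m k)) - f z)| <= m%:R * e.
Proof.
move=> e0; pose e' := e * (1 - x) / 3.
have e'0 : 0 < e' by rewrite divr_gt0// mulr_gt0.
have [d d0 lin] := slice_linear_approx uI fr r1 e'0.
have zK : slice_cball I r z by split => //; exact: ltW.
pose n := Num.bound (2 / d).
have n2 : 2 / d < n%:R by apply: archi_boundP; rewrite divr_ge0// ltW.
have n0 : 0 < n%:R :> R by apply: le_lt_trans n2; rewrite divr_ge0// ltW.
pose m0 := Num.bound (4 * pi / d).
exists (maxn 2 m0) => m; rewrite geq_max => /andP[m2 m0m].
have m_gt0 : 0 < m%:R :> R by rewrite ltr0n (leq_trans _ m2).
have md : 4 * pi / m%:R < d.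
  rewrite ltr_pdivrMr// -ltr_pdivrMl// mulrC.
  have := archi_boundP (_ : 0 <= 4 * pi / d); rewrite -/m0 => H.
  apply: lt_le_trans (H _) _; last by rewrite ler_nat.
  by rewrite divr_ge0 ?mulr_ge0 ?pi_ge0// ltW.
pose th k := root_angle R m k; pose zeta k := circle_point I r (th k).
pose a k := (1 - ratio (th k))^-1.
pose p i k := z + (i%:R / n%:R) *: (zeta k - z).
have zetaK k : slice_cball I r (zeta k) by exact: circle_point_in.
have zetaz k : `|zeta k - z| <= 2.
  apply: le_trans (ler_normB _ _) _.
  by rewrite /zeta circle_point_norm//; have := r1; have := zr; lra.
pose err i k := f (p i.+1 k) - f (p i k) -
  n%:R^-1 *: ((zeta k - z) * F (p i.+1 k)).
have errP i k : (i < n)%N -> `|err i k| <= e' * (2 / n%:R).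
  move=> i_n; have [i1 i0] := subdivision_in01 R i_n.
  have pK := slice_cball_convex zK (zetaK k) i0.
  have pK' := slice_cball_convex zK (zetaK k) i1.
  rewrite -/(p i k) in pK; rewrite -/(p i.+1 k) in pK'.
  have pp : p i k - p i.+1 k = - (n%:R^-1 *: (zeta k - z)).
    rewrite /p opprD addrACA subrr add0r -scalerBl -mulrBl -opprB -natrB//.
    by rewrite subSnn mulN1r scaleNr.
  have npp : `|p i k - p i.+1 k| <= 2 / n%:R.
    rewrite pp normrN normrZ gtr0_norm ?invr_gt0// mulrC.
    by rewrite ler_wpM2r// invr_ge0 ltW.
  have -> : err i k = - (f (p i k) - f (p i.+1 k) - (p i k - p i.+1 k) * F (p i.+1 k)).
    by rewrite pp mulNr opprK opprD opprB -[_ *: _ * _]scalerAl.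
  rewrite normrN; have [_ pI] := pK.
  apply: le_trans (lin _ _ pK' pI _) _; last by rewrite ler_wpM2l// ltW.
  apply: le_lt_trans npp _; rewrite ltr_pdivrMr// mulrC -ltr_pdivrMr//.
have incr k : a k * (f (zeta k) - f z) = \sum_(i < n)
    (n%:R^-1 *: (zeta k * F (p i.+1 k)) + a k * err i k).
  pose h (l : R) := f (z + l *: (zeta k - z)).
  have -> : f (zeta k) - f z = h 1 - h 0.
    by rewrite /h scale1r scale0r addr0 [z + _]addrC subrK.
  rewrite (subdivision h (_ : 0 < n)%N); last by rewrite -(ltr0n R).
  rewrite mulr_sumr; apply: eq_bigr => i _.
  have -> : a k * err i k = a k * (f (p i.+1 k) - f (p i k)) -
      n%:R^-1 *: (zeta k * F (p i.+1 k)).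
    by rewrite /err [LHS]mulrBr -[X in _ - X = _]scalerAr [a k * (_ * F _)]mulrA kernelE.
  by rewrite [RHS]addrC subrK.
under eq_bigr do rewrite incr.
rewrite exchange_big/=; apply: le_trans (ler_norm_sum _ _ _) _.
have step i : (i < n)%N ->
    `|\sum_(k < m) (n%:R^-1 *: (zeta k * F (p i.+1 k)) + a k * err i k)| <=
    n%:R^-1 * (m%:R * e).
  move=> i_n; rewrite big_split/= -scaler_sumr.
  apply: le_trans (ler_normD _ _) _; rewrite normrZ gtr0_norm ?invr_gt0//.
  have l01 : 0 < (i.+1%:R / n%:R : R) <= 1.
    by rewrite divr_gt0//= ler_pdivrMr// mul1r ler_nat.
  have D1 := derivative_mean_small uI r01 e'0 lin zK l01 m2 md.
  have D2 : `|\sum_(k < m) a k * err i k| <= m%:R * ((1 - x)^-1 * (e' * (2 / n%:R))).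
    apply: le_trans (ler_norm_sum _ _ _) _.
    apply: (@le_trans _ _ (\sum_(k < m) (1 - x)^-1 * (e' * (2 / n%:R)))).
      apply: ler_sum => k _; rewrite quat_normM.
      by rewrite ler_pM// ?errP// norm_kernel.
    by rewrite sumr_const card_ord -[_ *+ m]mulr_natl.
  have D1' : n%:R^-1 * `|\sum_(k < m) zeta k * F (p i.+1 k)| <= n%:R^-1 * (m%:R * e').
    rewrite ler_wpM2l ?invr_ge0 ?(ltW n0)//; apply: le_trans D1 _.
    by rewrite ler_wpM2l ?(ltW m_gt0)// ler_piMr// ltW.
  apply: le_trans (lerD D1' D2) _.
  have -> : m%:R * ((1 - x)^-1 * (e' * (2 / n%:R))) = n%:R^-1 * (m%:R * (e * 2 / 3)).
    by rewrite /e'; field; rewrite !gt_eqF.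
  rewrite -mulrDr ler_wpM2l ?invr_ge0 ?(ltW n0)// -mulrDr ler_wpM2l ?(ltW m_gt0)//.
  have : e' <= e / 3.
    rewrite /e' ler_wpM2r ?invr_ge0//.
    by rewrite ler_piMr ?(ltW e0)//; case/andP: x01 => ? _; lra.
  by lra.
apply: (@le_trans _ _ (\sum_(i < n) n%:R^-1 * (m%:R * e))).
  by apply: ler_sum => i _; exact: step.
by rewrite sumr_const card_ord -[_ *+ n]mulr_natl mulVKf// gt_eqF.
Qed.

End Point.

Lemma slice_bounded : exists2 C, 0 <= C &
  forall q, slice_cball I r q -> `|f q| <= C.
Proof.
have [L L0 Lf] := slice_lipschitz uI fr r01.
have K0 : slice_cball I r 0.
  split; first by rewrite /= normr0 ltW.
  by exists 0, 0; rewrite !scale0r addr0.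
exists (L * r + `|f 0|) => [|q qK]; first by rewrite addr_ge0// mulr_ge0// ltW.
rewrite -(subrK (f 0) (f q)); apply: le_trans (ler_normD _ _) _.
rewrite lerD2r; apply: le_trans (Lf _ _ K0 qK) _.
by rewrite subr0 ler_wpM2l//; have [] := qK.
Qed.

(** Its mean over t is the n-th Taylor coefficient, by Cauchy's formula. *)
Definition fourier_term n t : quat R :=
  r^-1 ^+ n *: (expI I (- (n%:R * t)) * f (circle_point I r t)).

Lemma fourier_term_lipschitz n :
  exists D, forall s t, `|fourier_term n s - fourier_term n t| <= D * `|s - t|.
Proof.
have [L L0 Lf] := slice_lipschitz uI fr r01; have [C C0 Cf] := slice_bounded.
exists (r^-1 ^+ n * (2 * n%:R * C + L * (r * 2))) => s t.
rewrite /fourier_term -scalerBr normrZ ger0_norm ?exprn_ge0 ?invr_ge0 ?(ltW r0)//.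
rewrite -[leRHS]mulrA ler_wpM2l ?exprn_ge0 ?invr_ge0 ?(ltW r0)//.
set E := expI I; set g := circle_point I r.
have -> : E (- (n%:R * s)) * f (g s) - E (- (n%:R * t)) * f (g t) =
    (E (- (n%:R * s)) - E (- (n%:R * t))) * f (g s) +
    E (- (n%:R * t)) * (f (g s) - f (g t)).
  by rewrite mulrBl mulrBr addrA subrK.
apply: le_trans (ler_normD _ _) _; rewrite !quat_normM mulrDl lerD//.
  rewrite mulrAC ler_pM//; last by rewrite Cf//; exact: circle_point_in.
  apply: le_trans (expI_lipschitz _ _ uI) _; rewrite -mulrA ler_wpM2l//.
  by rewrite opprK addrC -mulrBr normrM normr_nat distrC.
rewrite norm_expI// mul1r; apply: le_trans (Lf _ _ _ _) _; try exact: circle_point_in.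
rewrite -mulrA ler_wpM2l// /g /circle_point -scalerBr normrZ gtr0_norm//.
by rewrite -mulrA ler_wpM2l ?(ltW r0)//; exact: expI_lipschitz.
Qed.

Lemma ratio_expX z n t : slice_plane I z ->
  ratio z t ^+ n = z ^+ n * (r^-1 ^+ n *: expI I (- (n%:R * t))).
Proof.
move=> zI; rewrite /ratio exprMn_comm; last first.
  by apply: (@in_plane_comm _ I) => //; apply: in_planeZ; exact: expI_in_plane.
by rewrite exprZn expIX// mulrN.
Qed.

Lemma sum_ratio z n m : slice_plane I z -> (n < m)%N ->
  \sum_(k < m) ratio z (root_angle R m k) ^+ n = (m%:R * (n == 0%N)%:R)%:A.
Proof.
move=> zI nm; under eq_bigr do rewrite ratio_expX// expI_opp.
rewrite -mulr_sumr -scaler_sumr sum_roots//; last exact: imag_unitsN.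
have [->|_] := eqVneq n 0%N; first by rewrite !expr0 mul1r scale1r.
by rewrite mulr0 scale0r scaler0 mulr0.
Qed.

(** Expanding the kernel in Cauchy's formula into a geometric series. The
    nodes are the 2^s-th roots of unity, for which the Fourier means
    converge. *)
Lemma slice_taylor : exists a : nat -> quat R,
  (exists C, forall n, `|a n| <= C * r^-1 ^+ n) /\
  forall z, slice_plane I z -> `|z| < r ->
    series (fun n => z ^+ n * a n) @ \oo --> f z.
Proof.
have [C C0 Cf] := slice_bounded.
pose A n s := (2 ^+ s)^-1 *:
  \sum_(k < (2 ^ s)%N) fourier_term n (root_angle R (2 ^ s)%N k).
have [aD aDP] : exists aD : nat -> quat R * R, forall n s,
    `|(aD n).1 - A n s| <= (aD n).2 * 2^-1 ^+ s.
  suff /choice[aD] : forall n, exists y : quat R * R,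
    forall s, `|y.1 - A n s| <= y.2 * 2^-1 ^+ s by exists aD.
  move=> n; have [D /mean_lipschitz_cvg[l [c lc]]] := fourier_term_lipschitz n.
  by exists (l, c).
pose a n := (aD n).1; pose D n := (aD n).2.
have h01 : 0 <= (2^-1 : R) < 1 by rewrite invr_ge0 ler0n/= invf_lt1// ltr1n.
have fourier_le n t : `|fourier_term n t| <= C * r^-1 ^+ n.
  rewrite /fourier_term normrZ ger0_norm ?exprn_ge0 ?invr_ge0 ?(ltW r0)//.
  rewrite mulrC ler_wpM2r ?exprn_ge0 ?invr_ge0 ?(ltW r0)//.
  by rewrite quat_normM norm_expI// mul1r Cf//; exact: circle_point_in.
exists a; split.
  exists C => n; apply: (le_geometric_error (C := D n) (N0 := 0) h01) => s _.
  rewrite -(subrK (A n s) (a n)); apply: le_trans (ler_normD _ _) _.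
  rewrite addrC lerD ?aDP// /A normrZ gtr0_norm ?invr_gt0 ?exprn_gt0//.
  rewrite mulrC ler_pdivrMr ?exprn_gt0//; apply: le_trans (ler_norm_sum _ _ _) _.
  apply: (@le_trans _ _ (\sum_(k < (2 ^ s)%N) C * r^-1 ^+ n)).
    by apply: ler_sum => k _.
  by rewrite sumr_const card_ord -[_ *+ _]mulr_natr natrX.
move=> z zI zr; pose x := `|z| / r.
have x01 : 0 <= x < 1.
  by rewrite /x divr_ge0 ?(ltW r0)//= ltr_pdivrMr// mul1r.
have fz : `|f z| <= C by apply: Cf; split => //; exact: ltW.
pose c := (1 - x)^-1 * (C + C).
have partial N e : (0 < N)%N -> 0 < e ->
    `|\sum_(n < N) z ^+ n * a n - f z| <= e + c * x ^+ N.
  move=> N0 e0; have [m0 cau] := cauchy_mean_small zI zr e0.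
  apply: (le_geometric_error (C := \sum_(n < N) `|z| ^+ n * D n)
    (N0 := maxn m0 N) h01) => s; rewrite geq_max => /andP[m0s Ns].
  have s2 : (s < 2 ^ s)%N by exact: ltn_expl.
  have {cau} := cau (2 ^ s)%N (leq_trans m0s (ltnW s2)).
  have mN : (N <= 2 ^ s)%N by exact: leq_trans Ns (ltnW s2).
  set m := (2 ^ s)%N in s2 mN *.
  have mE : m%:R = 2 ^+ s :> R by rewrite natrX.
  have m_gt0 : 0 < m%:R :> R by rewrite mE exprn_gt0.
  pose y k := ratio z (root_angle R m k).
  pose g k := f (circle_point I r (root_angle R m k)) - f z.
  have gC k : `|g k| <= C + C.
    apply: le_trans (ler_normB _ _) _; rewrite lerD//.
    by apply: Cf; exact: circle_point_in.
  have kerE : \sum_(k < m) (1 - y k)^-1 * g k =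
      m%:R *: (\sum_(n < N) z ^+ n * A n s - f z) +
      \sum_(k < m) (1 - y k)^-1 * y k ^+ N * g k.
    under eq_bigr do rewrite [(1 - y _)^-1](kernel_expansion zr _ N) mulrDl.
    rewrite big_split/=; congr (_ + _).
    under eq_bigr do rewrite mulr_suml.
    rewrite exchange_big/=.
    have -> : \sum_(n < N) \sum_(k < m) y k ^+ n * g k =
        \sum_(n < N) (m%:R *: (z ^+ n * A n s) - (m%:R * (n == 0%N :> nat)%:R)%:A * f z).
      apply: eq_bigr => n _; under eq_bigr do rewrite /g mulrBr.
      rewrite sumrB -mulr_suml sum_ratio//; last exact: leq_trans mN.
      congr (_ - _); rewrite /A -scalerAr scalerA mE divff ?gt_eqF ?exprn_gt0//.
      rewrite scale1r mulr_sumr; apply: eq_bigr => k _.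
      by rewrite /y ratio_expX// -mulrA /fourier_term -scalerAl.
    rewrite sumrB scalerBr -scaler_sumr; congr (_ - _).
    rewrite -mulr_suml; case: N N0 {Ns mN} => // N _.
    rewrite big_ord_recl big1 ?addr0 => [|i _]; last by rewrite mulr0 scale0r.
    by rewrite mulr1 -scalerAl mul1r.
  have rem : `|\sum_(k < m) (1 - y k)^-1 * y k ^+ N * g k| <= m%:R * (c * x ^+ N).
    apply: le_trans (ler_norm_sum _ _ _) _.
    apply: (@le_trans _ _ (\sum_(k < m) c * x ^+ N)).
      apply: ler_sum => k _; rewrite !quat_normM quat_normX ratio_norm//.
      rewrite /c mulrAC ler_wpM2r ?exprn_ge0//.
        by case/andP: x01.
      by rewrite ler_pM// norm_kernel.
    by rewrite sumr_const card_ord -[_ *+ m]mulr_natl.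
  rewrite kerE => cau.
  have main : `|\sum_(n < N) z ^+ n * A n s - f z| <= e + c * x ^+ N.
    rewrite -(ler_pM2l m_gt0) -[X in X * `|_|](gtr0_norm m_gt0) -normrZ.
    set T := \sum_(k < m) _ in rem cau; set S := _ *: _ in cau *.
    rewrite -[S](addrK T); apply: le_trans (ler_normB _ _) _.
    by rewrite mulrDr lerD.
  have diff : `|\sum_(n < N) z ^+ n * a n - \sum_(n < N) z ^+ n * A n s| <=
      (\sum_(n < N) `|z| ^+ n * D n) * 2^-1 ^+ s.
    rewrite -sumrB mulr_suml; apply: le_trans (ler_norm_sum _ _ _) _.
    apply: ler_sum => n _; rewrite -mulrBr quat_normM quat_normX -mulrA.
    by rewrite ler_wpM2l ?exprn_ge0// aDP.
  rewrite -(subrK (\sum_(n < N) z ^+ n * A n s) (\sum_(n < N) z ^+ n * a n)) -addrA.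
  by apply: le_trans (ler_normD _ _) _; rewrite [leRHS]addrC lerD.
apply/cvgrPdist_lt => e e0; have e2 : 0 < e / 2 by rewrite divr_gt0.
have [N0 cN] := geometric_small c x01 e2.
exists N0.+1 => // N /= N0N; rewrite /series/= big_mkord distrC.
have [N1 N2] : (0 < N)%N /\ (N0 <= N)%N by split; [exact: leq_ltn_trans N0N|exact: ltnW].
apply: le_lt_trans (partial N _ N1 e2) _.
by rewrite [ltRHS](splitr e) ltrD2l cN.
Qed.

End PowerSeries.

(** * The power series of a slice regular function *)

Section Coefs.
Variable R : realType.
Implicit Types (f : quat R -> quat R) (a e : nat -> quat R) (q : quat R).

(** The first nonzero coefficient would dominate the series at small real
    points. The real axis being common to all slices, the expansions on
    different slices and discs therefore agree. *)
Lemma power_series_unique e (C s rho : R) : 0 < rho -> 1 <= s ->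
  (forall n, `|e n| <= C * s ^+ n) ->
  (forall t : R, 0 < t < rho ->
     series (fun n => (t%:A : quat R) ^+ n * e n) @ \oo --> (0 : quat R)) ->
  forall n, e n = 0.
Proof.
move=> rho0 s1 eC e0; have C0 : 0 <= C.
  by have := eC 0%N; rewrite expr0 mulr1; exact: le_trans.
have s0 : 0 < s by exact: lt_le_trans s1.
elim/ltn_ind => n IHn; apply/eqP; rewrite -normr_le0.
have h01 : 0 <= (2^-1 : R) < 1 by rewrite invr_ge0 ler0n/= invf_lt1// ltr1n.
(* For t below tau the ratio t * s of the tail is at most one half. *)
pose tau := Num.min (rho / 2) (2 * s)^-1.
have tau0 : 0 < tau by rewrite lt_min divr_gt0// invr_gt0 mulr_gt0.
apply: (le_geometric_error (C := 2 * C * s ^+ n.+1 * tau) (N0 := 0) h01) => N _.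
rewrite add0r; pose t := tau * 2^-1 ^+ N.
have t0 : 0 < t by rewrite mulr_gt0// exprn_gt0// invr_gt0.
have ttau : t <= tau.
  by rewrite ler_piMr ?(ltW tau0)// exprn_ile1// ?invr_ge0// invf_le1// ler1n.
have trho : t < rho.
  apply: le_lt_trans ttau _; rewrite gt_min; apply/orP; left.
  by rewrite ltr_pdivrMr// ltr_pMr// ltr1n.
have ts : t * s <= 2^-1.
  apply: (@le_trans _ _ ((2 * s)^-1 * s)).
    rewrite ler_wpM2r ?(ltW s0)//; apply: le_trans ttau _.
    by rewrite ge_min lexx orbT.
  by rewrite invfM -mulrA mulVf ?mulr1// gt_eqF.
have ts01 : 0 <= t * s < 1.
  rewrite mulr_ge0 ?ltW//=; apply: le_lt_trans ts _; by case/andP: h01.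
have [|_ tail] := @geometric_tail _ (fun n => (t%:A : quat R) ^+ n * e n) C _ ts01.
  move=> k; rewrite quat_normM quat_normX quat_norm_alg gtr0_norm// [_ ^+ k in leRHS]exprMn.
  by rewrite [leRHS]mulrCA ler_wpM2l// exprn_ge0// ltW.
have {tail} := tail n.+1; rewrite (cvg_lim _ (e0 t _))//; last by rewrite t0.
rewrite sub0r normrN big_ord_recr/= big1 ?add0r => [|i _]; last first.
  by rewrite IHn ?mulr0.
rewrite quat_normM quat_normX quat_norm_alg gtr0_norm// => tn.
have tn0 : 0 < t ^+ n by rewrite exprn_gt0.
rewrite -(ler_pM2l tn0); apply: le_trans tn _.
have -> : t ^+ n * (2 * C * s ^+ n.+1 * tau * 2^-1 ^+ N) =
    2 * C * (t * s) ^+ n.+1.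
  by rewrite [(t * s) ^+ _]exprMn [t ^+ n.+1]exprSr /t; ring.
rewrite ler_wpM2r ?exprn_ge0//; first by case/andP: ts01.
rewrite ler_pdivrMr; last by rewrite subr_gt0; case/andP: ts01.
by nra.
Qed.

Lemma slice_regular_expansion f : slice_regular f -> exists a : nat -> quat R,
  forall q, qball 1 q -> series (fun n => q ^+ n * a n) @ \oo --> f q.
Proof.
move=> fr; have [I0 uI0 _] := in_some_slice (0 : quat R).
have h01 : 0 < (2^-1 : R) < 1 by rewrite invr_gt0 ltr0n/= invf_lt1// ltr1n.
have [a [[C aC] aE]] := slice_taylor uI0 fr h01.
exists a => q; rewrite /qball/= => q1; have [I uI qI] := in_some_slice q.
pose r := (1 + `|q|) / 2; have q0 : 0 <= `|q| by [].
have r01 : 0 < r < 1 by apply/andP; split; rewrite /r; lra.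
have rge : 2^-1 <= r by rewrite /r; lra.
have r0 : 0 < r by case/andP: r01.
have [a' [[C' a'C] a'E]] := slice_taylor uI fr r01.
suff -> : a = a' by apply: a'E => //; rewrite /r; lra.
apply/funext => n; apply/eqP; rewrite -subr_eq0; apply/eqP; move: n.
apply: (@power_series_unique (fun n => a n - a' n) (C + C') 2 2^-1) => //.
- by rewrite ler1n.
- have C'0 : 0 <= C' by have := a'C 0%N; rewrite expr0 mulr1; exact: le_trans.
  move=> n; apply: le_trans (ler_normB _ _) _; rewrite mulrDl lerD//.
    by apply: le_trans (aC n) _; rewrite invrK.
  apply: le_trans (a'C n) _; rewrite ler_wpM2l// lerXn2r ?nnegrE ?invr_ge0 ?(ltW r0)//.
  by rewrite -[leRHS]invrK lef_pV2 ?posrE// invr_gt0.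
move=> t /andP[t0 t2]; have nt : `|t%:A : quat R| = t.
  by rewrite quat_norm_alg gtr0_norm.
rewrite -(subrr (f t%:A)) (_ : series _ = series (fun n => (t%:A : quat R) ^+ n * a n) -
  series (fun n => (t%:A : quat R) ^+ n * a' n)).
  apply: cvgB; first by apply: aE; [exact: in_plane_alg|rewrite nt].
  by apply: a'E; [exact: in_plane_alg|rewrite nt; exact: lt_le_trans rge].
apply/funext => n; rewrite /series/= -[RHS]/(_ - _) -sumrB.
by apply: eq_bigr => k _; rewrite mulrBr.
Qed.

Lemma coefs_cvg f q : slice_regular f -> `|q| < 1 ->
  series (fun n => q ^+ n * coefs f n) @ \oo --> f q.
Proof. by move=> /slice_regular_expansion/getPex; exact. Qed.

Lemma coefs_subgeometric f : slice_regular f -> subgeometric (coefs f).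
Proof.
move=> fr s s1; have s0 : 0 < s by exact: lt_trans s1.
have nq : `|s^-1%:A : quat R| = s^-1 by rewrite quat_norm_alg gtr0_norm// invr_gt0.
have := @coefs_cvg f (s^-1%:A) fr; rewrite nq invf_lt1// => /(_ s1) /cvgP.
move=> /cvg_series_cvg_0/cvgP/cvg_seq_bounded[B [_ BP]].
exists (`|B| + 1) => n.
have := BP (`|B| + 1) _ n I; rewrite /= quat_normM quat_normX nq exprVn.
rewrite mulrC ler_pdivrMr ?exprn_gt0//; apply.
by rewrite (le_lt_trans (ler_norm _))// ltrDl.
Qed.

Lemma psum_coefs f q : slice_regular f -> `|q| < 1 -> psum (coefs f) q = f q.
Proof. by move=> fr q1; apply: cvg_lim => //; exact: coefs_cvg. Qed.

Lemma slice_derivative0 f : slice_regular f ->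
  slice_derivative f 0 = coefs f 1%N.
Proof.
move=> fr; have [|C aC] := coefs_subgeometric fr (_ : 1 < 2).
  by rewrite ltr1n.
have C0 : 0 <= C by have := aC 0%N; rewrite expr0 mulr1; exact: le_trans.
rewrite /slice_derivative; apply: cvg_lim => //.
apply/cvgrPdist_le => eps eps0.
pose d := Num.min 4^-1 (eps / (8 * C + 1)).
have d0 : 0 < d by rewrite lt_min invr_gt0 ltr0n divr_gt0// ltr_wpDl// mulr_ge0.
exists d => //= h; rewrite /ball_/= sub0r normrN => hd h0.
have {hd} [h4 heps] : `|h| < 4^-1 /\ `|h| < eps / (8 * C + 1).
  by move: hd; rewrite lt_min => /andP[].
have nh : 0 < `|h| by rewrite normr_gt0.
have y01 : 0 <= 2 * `|h| < 1 by rewrite mulr_ge0//=; lra.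
have [|_ tail] := @geometric_tail _ (fun n => (h%:A : quat R) ^+ n * coefs f n) C _ y01.
  move=> k; rewrite quat_normM quat_normX quat_norm_alg exprMn.
  by rewrite mulrA [leRHS]mulrC ler_wpM2l.
have := tail 2%N; rewrite (cvg_lim _ (coefs_cvg fr _))//; last first.
  by rewrite quat_norm_alg; lra.
have f0 : f 0 = coefs f 0%N by rewrite -psum_coefs ?psum0// normr0.
rewrite !big_ord_recl big_ord0 addr0 expr0 expr1 mul1r -f0 => tl.
rewrite addr0 -(ler_pM2l nh).
have -> : `|h| * `|coefs f 1%N - h^-1 *: (f (h *: 1) - f 0)| =
    `|f h%:A - (f 0 + h%:A * coefs f 1%N)|.
  rewrite -normrZ scalerBr scalerA divff// scale1r -normrN opprB.
  by rewrite -scalerAl mul1r opprD addrA.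
apply: le_trans tl _; rewrite expr2.
have y2 : (1 - 2 * `|h|)^-1 <= 2.
  by rewrite -[leRHS]invrK lef_pV2 ?posrE ?invr_gt0//; lra.
have heps' : `|h| * (8 * C + 1) < eps by rewrite -ltr_pdivlMr// ltr_wpDl// mulr_ge0.
have := ler_wpM2l C0 y2; set w := C / _ => w2.
have : w * (2 * `|h| * (2 * `|h|)) <= C * 2 * (2 * `|h| * (2 * `|h|)).
  by rewrite ler_wpM2r// !mulr_ge0.
have : `|h| * (`|h| * (8 * C + 1)) <= `|h| * eps by rewrite ler_pM2l// ltW.
have : 0 <= `|h| * `|h| by rewrite mulr_ge0.
by lra.
Qed.

End Coefs.

(** * Bounded power series on a slice *)

Section Bounded.
Variables (R : realType) (I : quat R) (e : nat -> quat R).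
Hypotheses (uI : imag_units I) (eg : subgeometric e).
Implicit Types (u v z : quat R) (M rho r : R).

(** The coefficients of M - v e(z) u. For unit u and v, with v in the slice, its
    real part is nonnegative where M bounds the modulus of e(z). *)
Definition deficit M v u n : quat R :=
  (if n == 0%N then M%:A else 0) + - v * e n * u.

Lemma deficit_subgeometric M v u : subgeometric (deficit M v u).
Proof.
apply: subgeometricD; first exact: subgeometric_const.
by apply: subgeometricMr; exact: subgeometricMl.
Qed.

Lemma psum_deficit M v u z : slice_plane I v -> slice_plane I z -> `|z| < 1 ->
  psum (deficit M v u) z = M%:A - v * psum e z * u.
Proof.
move=> vI zI z1; rewrite psumD//; last 2 first.
- exact: subgeometric_const.
- by apply: subgeometricMr; exact: subgeometricMl.
rewrite psum_const psumM//; first by rewrite !mulNr.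
by apply: (@in_plane_comm _ I) => //; exact: in_planeN.
Qed.

Lemma deficit_ge0 M v u z : slice_plane I v -> `|v| = 1 -> `|u| = 1 ->
  slice_plane I z -> `|z| < 1 -> `|psum e z| <= M ->
  0 <= qre (psum (deficit M v u) z).
Proof.
move=> vI v1 u1 zI z1 eM; rewrite psum_deficit// qreB qreZ mulr1 subr_ge0.
by apply: le_trans (ler_qre _) _; rewrite !quat_normM v1 u1 mul1r mulr1.
Qed.

Lemma qre_deficit0 M v u : qre (deficit M v u 0) = M - qre (v * e 0%N * u).
Proof. by rewrite /deficit eqxx !mulNr qreB qreZ mulr1. Qed.

(** Harnack's inequality for the real part of M - e(z) u, in every direction u. *)
Lemma harnack_norm M rho z : slice_plane I z -> `|z| < rho -> rho < 1 ->
  (forall w, slice_plane I w -> `|w| = rho -> `|psum e w| <= M) ->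
  `|e 0%N| <= M /\
  `|psum e z| <= M - (1 - `|z| / rho) / (1 + `|z| / rho) * (M - `|e 0%N|).
Proof.
move=> zI zrho rho1 eM; have rho0 : 0 < rho by exact: le_lt_trans zrho.
have [t _ zE] := plane_polar uI zI; pose z0 := rho *: expI I t.
have nz0 s : `|z0 * expI I s| = rho.
  by rewrite quat_normM normrZ !norm_expI// !mulr1 gtr0_norm.
have nz0' : `|z0| < 1 by rewrite normrZ norm_expI// mulr1 gtr0_norm.
have z0I : slice_plane I z0 by apply: in_planeZ; exact: expI_in_plane.
have z0sI s : slice_plane I (z0 * expI I s).
  by apply: in_planeM => //; exact: expI_in_plane.
have x01 : 0 <= `|z| / rho < 1.
  by rewrite divr_ge0 ?(ltW rho0)//= ltr_pdivrMr// mul1r.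
have pos u : `|u| = 1 -> forall s, 0 <= qre (psum (deficit M 1 u) (z0 * expI I s)).
  move=> u1 s; apply: deficit_ge0 => //; rewrite ?nz0//.
  - exact: in_plane1.
  - exact: quat_norm1.
  - exact: eM.
have e0M : `|e 0%N| <= M.
  apply: quat_norm_le_qre => u u1.
  have := mean_kernel_ge0 (kappa := fun=> 1) (N := 0) uI z0I nz0'
    (deficit_subgeometric M 1 u) (pos u u1).
  rewrite big_ord_recl big_ord0 addr0 expr0 !mul1r qre_deficit0 mul1r => H.
  have {}H := H _; suff : 0 <= (M - qre (e 0%N * u)) + (M - qre (e 0%N * u)) by lra.
  by apply: H => s; rewrite big_ord_recl big_ord0 addr0 mul0r cos0 mul1r.
split=> //; apply: quat_norm_le_qre => u u1.
have := harnack uI z0I nz0' (deficit_subgeometric M 1 u) (pos u u1) x01.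
have -> : (`|z| / rho) *: z0 = z.
  by rewrite /z0 scalerA divfK ?gt_eqF// -zE.
rewrite psum_deficit//; [|exact: in_plane1|exact: lt_trans rho1].
rewrite qre_deficit0 !mul1r qreB qreZ mulr1.
have x1 : 0 < 1 - `|z| / rho by rewrite subr_gt0; case/andP: x01.
have x1' : 0 < 1 + `|z| / rho by rewrite ltr_pwDl//; case/andP: x01.
have e0u : M - `|e 0%N| <= M - qre (e 0%N * u).
  rewrite lerD2l lerN2; apply: le_trans (ler_qre _) _.
  by rewrite quat_normM u1 mulr1.
have := ler_wpM2l (ltW (divr_gt0 x1 x1')) e0u.
by lra.
Qed.

Lemma max_modulus M rho z : slice_plane I z -> `|z| < rho -> rho < 1 ->
  (forall w, slice_plane I w -> `|w| = rho -> `|psum e w| <= M) ->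
  `|psum e z| <= M.
Proof.
move=> zI zrho rho1 eM; have [e0M] := harnack_norm zI zrho rho1 eM.
have rho0 : 0 < rho by exact: le_lt_trans zrho.
move=> /le_trans; apply; rewrite gerBl mulr_ge0 ?subr_ge0//.
rewrite divr_ge0 ?subr_ge0 ?addr_ge0 ?divr_ge0 ?(ltW rho0)//.
by rewrite ler_pdivrMr// mul1r ltW.
Qed.

(** Schwarz's lemma for a zero of order three: the maximum modulus principle on
    the circle of radius rho gives the bound M / rho^3, and rho tends to 1. *)
Lemma schwarz3 M : 0 <= M ->
  (forall z, slice_plane I z -> `|z| < 1 -> `|z ^+ 3 * psum e z| <= M) ->
  forall z, slice_plane I z -> `|z| < 1 -> `|psum e z| <= M.
Proof.
move=> M0 eM z zI z1.
have h01 : 0 <= (2^-1 : R) < 1 by rewrite invr_ge0 ler0n/= invf_lt1// ltr1n.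
apply: (le_geometric_error (C := 3 * `|psum e z| * (1 - `|z|)) (N0 := 1) h01) => N N1.
pose d := (1 - `|z|) * 2^-1 ^+ N; pose rho := 1 - d.
have z1' : 0 < 1 - `|z| by rewrite subr_gt0.
have d0 : 0 < d by rewrite mulr_gt0// exprn_gt0// invr_gt0.
have dz : d < 1 - `|z|.
  rewrite gtr_pMr// exprn_ilt1 ?invr_ge0 -?lt0n//; by case/andP: h01.
have nz := normr_ge0 z.
have zrho : `|z| < rho by rewrite /rho; lra.
have rho0 : 0 < rho by lra.
have rho1 : rho < 1 by rewrite /rho; lra.
have := @max_modulus (M / rho ^+ 3) rho z zI zrho rho1.
set p := `|psum e z| => pM; have {}pM : p * rho ^+ 3 <= M.
  rewrite -ler_pdivlMr ?exprn_gt0//; apply: pM => w wI w1.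
  rewrite ler_pdivlMr ?exprn_gt0// -w1 -quat_normX mulrC -quat_normM.
  by apply: eM => //; rewrite w1.
have p0 : 0 <= p by exact: normr_ge0.
have rho3 : 1 - 3 * d <= rho ^+ 3.
  rewrite /rho; have -> : (1 - d) ^+ 3 = 1 - 3 * d + d ^+ 2 * (3 - d) by ring.
  by rewrite lerDl mulr_ge0 ?sqr_ge0//; lra.
have := ler_wpM2l p0 rho3; have -> : p * (1 - 3 * d) = p - 3 * (p * d) by ring.
have -> : 3 * p * (1 - `|z|) * 2^-1 ^+ N = 3 * (p * d) by rewrite /d !mulrA.
by lra.
Qed.

(** The coefficient inequality on the circle of radius 1/2. The right-hand side
    measures how far the leading coefficient is from the bound. *)
Lemma caratheodory_norm M v u s n : (0 < n)%N ->
  slice_plane I v -> `|v| = 1 -> `|u| = 1 ->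
  (forall z, slice_plane I z -> `|z| < 1 -> `|psum e z| <= M) ->
  qre (expI I s * v * e n * u) <= 2 ^+ n * (2 * (M - qre (v * e 0%N * u))).
Proof.
(* The n-th power of z0 has argument s. *)
move=> n0 vI v1 u1 eM; pose z0 := 2^-1 *: expI I (s / n%:R).
have nn0 : n%:R != 0 :> R by rewrite pnatr_eq0 -lt0n.
have z0I : slice_plane I z0 by apply: in_planeZ; exact: expI_in_plane.
have nz0 t : `|z0 * expI I t| < 1.
  rewrite quat_normM normrZ !norm_expI// !mulr1 ger0_norm ?invr_ge0//.
  by rewrite invf_lt1// ltr1n.
have nz0' : `|z0| < 1 by have := nz0 0; rewrite expI0 mulr1.
have pos t : 0 <= qre (psum (deficit M v u) (z0 * expI I t)).
  have z0tI : slice_plane I (z0 * expI I t).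
    by apply: in_planeM => //; exact: expI_in_plane.
  by apply: deficit_ge0 => //; exact: eM.
have := caratheodory_coef uI z0I nz0' (deficit_subgeometric M v u) pos n0.
rewrite qre_deficit0 /deficit [n == 0%N]eqn0Ngt n0 add0r.
have -> : z0 ^+ n = 2^-1 ^+ n *: expI I s.
  by rewrite exprZn expIX// mulrC divfK.
rewrite -scalerAl qreZ !mulNr mulrN -[qre (- _)]/(- _) mulrN => H.
have p0 : 0 < 2 ^+ n :> R by rewrite exprn_gt0.
rewrite -(ler_pM2l (_ : 0 < 2^-1 ^+ n)) ?exprn_gt0 ?invr_gt0//.
rewrite [leRHS]mulrA -exprMn mulVf ?expr1n ?mul1r//.
by apply: le_trans H; rewrite !mulrA opprK.
Qed.

End Bounded.

(** * The 3-diameter of a ball *)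

Section ThreeDiameterBall.
Variable R : realType.
Implicit Types (w : quat R) (r x : R).

(** The cube of the 3-diameter of the unit ball. *)
Definition max_triangle : R := 3 * Num.sqrt 3.

Lemma max_triangle_gt0 : 0 < max_triangle.
Proof. by rewrite mulr_gt0// sqrtr_gt0. Qed.

Lemma max_triangle_sqr : max_triangle ^+ 2 = 27.
Proof. by rewrite exprMn sqr_sqrtr//; ring. Qed.

Lemma amgm3 (x y z : R) : 0 <= x -> 0 <= y -> 0 <= z ->
  27 * (x * y * z) <= (x + y + z) ^+ 3.
Proof.
move=> x0 y0 z0.
have -> : (x + y + z) ^+ 3 = 27 * (x * y * z)
    + (x + y + z) * ((x - y) ^+ 2 + (y - z) ^+ 2 + (z - x) ^+ 2) / 2
    + 3 * (x * (y - z) ^+ 2 + y * (z - x) ^+ 2 + z * (x - y) ^+ 2) by field.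
have sq a b : 0 <= a -> 0 <= a * b ^+ 2 :> R by move=> a0; rewrite mulr_ge0 ?sqr_ge0.
rewrite -addrA lerDl addr_ge0//; last by rewrite mulr_ge0// !addr_ge0 ?sq.
by rewrite divr_ge0// mulr_ge0 ?addr_ge0 ?sqr_ge0.
Qed.

(** The squares of the sides add up to at most 9 r^2, because they add up to
    three times the squares of the vertices minus the square of their sum. *)
Lemma triangle_le w1 w2 w3 r : `|w1| <= r -> `|w2| <= r -> `|w3| <= r ->
  `|w2 - w1| * `|w3 - w1| * `|w3 - w2| <= r ^+ 3 * max_triangle.
Proof.
move=> w1r w2r w3r; have r0 : 0 <= r by exact: le_trans w1r.
rewrite -(@ler_pXn2r _ 2) ?nnegrE ?mulr_ge0 ?exprn_ge0 ?(ltW max_triangle_gt0)//.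
rewrite [leRHS]exprMn max_triangle_sqr.
have -> : (`|w2 - w1| * `|w3 - w1| * `|w3 - w2|) ^+ 2 =
  `|w2 - w1| ^+ 2 * `|w3 - w1| ^+ 2 * `|w3 - w2| ^+ 2 by ring.
have sides : `|w2 - w1| ^+ 2 + `|w3 - w1| ^+ 2 + `|w3 - w2| ^+ 2 <= 9 * r ^+ 2.
  have : `|w1| ^+ 2 <= r ^+ 2 by rewrite lerXn2r ?nnegrE.
  have : `|w2| ^+ 2 <= r ^+ 2 by rewrite lerXn2r ?nnegrE.
  have : `|w3| ^+ 2 <= r ^+ 2 by rewrite lerXn2r ?nnegrE.
  have -> : `|w2 - w1| ^+ 2 + `|w3 - w1| ^+ 2 + `|w3 - w2| ^+ 2 =
      3 * (`|w1| ^+ 2 + `|w2| ^+ 2 + `|w3| ^+ 2) - `|w1 + w2 + w3| ^+ 2.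
    rewrite !quat_norm_sqr; case: w1 w2 w3 {w1r w2r w3r}.
    by move=> ? ? ? ? [? ? ? ?] [? ? ? ?]; rewrite /quat_sqnorm /=; ring.
  by have := sqr_ge0 `|w1 + w2 + w3|; lra.
have := amgm3 (sqr_ge0 `|w2 - w1|) (sqr_ge0 `|w3 - w1|) (sqr_ge0 `|w3 - w2|).
set P := _ * _ * _ => PS.
have : (`|w2 - w1| ^+ 2 + `|w3 - w1| ^+ 2 + `|w3 - w2| ^+ 2) ^+ 3 <= (9 * r ^+ 2) ^+ 3.
  by rewrite lerXn2r ?nnegrE// ?addr_ge0 ?mulr_ge0 ?sqr_ge0.
have -> : (9 * r ^+ 2) ^+ 3 = 27 * ((r ^+ 3) ^+ 2 * 27) by ring.
by move=> /(le_trans PS); rewrite ler_pM2l.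
Qed.

Definition vandermonde w1 w2 w3 : quat R := (w2 - w1) * (w3 - w1) * (w3 - w2).

(** The angle 2 pi / 3 of the equilateral triangle, through its cosine. *)
Definition third_turn : R := acos (- 2^-1).

Lemma third_turn_cos : cos third_turn = - 2^-1.
Proof. by rewrite acosK// in_itv/=; apply/andP; split; lra. Qed.

Lemma third_turn_sin : sin third_turn = Num.sqrt 3 / 2.
Proof.
rewrite sin_acos; last by apply/andP; split; lra.
have -> : 1 - (- 2^-1) ^+ 2 = 3 * (2^-1) ^+ 2 :> R by field.
by rewrite sqrtrM// sqrtr_sqr ger0_norm.
Qed.

Lemma third_turn_sin_gt0 : 0 < sin third_turn.
Proof. by rewrite third_turn_sin divr_gt0// sqrtr_gt0. Qed.

Lemma third_turn_sin_sqr : sin third_turn * sin third_turn = 3 / 4.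
Proof.
rewrite third_turn_sin mulf_div -expr2 sqr_sqrtr//.
by congr (_ / _); rewrite -natrM.
Qed.

Lemma third_turn_mul (k : nat) : let t := k%:R * third_turn in
  [\/ cos t = 1 /\ sin t = 0, cos t = - 2^-1 /\ sin t = sin third_turn |
      cos t = - 2^-1 /\ sin t = - sin third_turn].
Proof.
have ss := third_turn_sin_sqr; have cc := third_turn_cos.
elim: k => [|k /= IHk]; first by rewrite /= mul0r cos0 sin0; apply: Or31.
rewrite /= -natr1 mulrDl mul1r cosD sinD cc.
case: IHk => -[-> ->].
- by apply: Or32; split; lra.
- by apply: Or33; split; lra.
- by apply: Or31; split; lra.
Qed.

(** The triangles (1, x, 1/x), with x on the unit circle of a slice, contain the
    equilateral one and all the perturbations of it that are needed. *)
Lemma isosceles_vandermonde I t : imag_units I ->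
  vandermonde 1 (expI I t) (expI I (- t)) =
  - (4 * (1 - cos t) * sin t) *: I.
Proof.
move=> uI; have II := imag_unit_sqr uI; have cs := cos2Dsin2 t.
rewrite /vandermonde.
rewrite (expI_sub1 I t) expIN_sub1 expIN_sub_expI.
rewrite !plane_mulE// (_ : _ - _ = 0) ?scale0r ?add0r.
  congr (_ *: _); move: cs; rewrite !expr2 => cs.
  have -> : (cos t - 1) * - sin t + sin t * (cos t - 1) = 0 by ring.
  rewrite mul0r addr0; have -> : (cos t - 1) * (cos t - 1) - sin t * - sin t =
    cos t * cos t + sin t * sin t - 2 * cos t + 1 by ring.
  by rewrite cs; ring.
by ring.
Qed.

Lemma cbrtE r : 0 <= r ->
  r * max_triangle `^ 3^-1 = (r ^+ 3 * max_triangle) `^ 3^-1.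
Proof.
move=> r0; rewrite powRM ?exprn_ge0 ?(ltW max_triangle_gt0)//.
by rewrite -(powR_mulrn 3 r0) -powRrM divff ?powRr1.
Qed.

Lemma d3_qball r : 0 < r -> d3 (qball r) = (r * max_triangle `^ 3^-1)%:E.
Proof.
move=> r0; have M0 := ltW max_triangle_gt0.
apply/eqP; rewrite eq_le; apply/andP; split.
  apply: ge_ereal_sup => _ [w1 [w2 [w3 [w1r w2r w3r ->]]]].
  rewrite lee_fin cbrtE ?(ltW r0)// ge0_ler_powR ?nnegrE ?mulr_ge0 ?exprn_ge0 ?(ltW r0)//.
  by apply: triangle_le; exact: ltW.
have mu0 : 0 <= max_triangle `^ 3^-1 by exact: powR_ge0.
apply/lee_mul01Pr; first by rewrite lee_fin mulr_ge0// ltW.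
move=> s /andP[s0 s1]; rewrite -EFinM mulrA.
have [I uI _] := in_some_slice (0 : quat R).
apply: ereal_sup_ubound => /=.
have sr0 : 0 < s * r by rewrite mulr_gt0.
have inB w : `|w| = 1 -> qball r ((s * r) *: w).
  by move=> w1; rewrite /qball/= normrZ w1 mulr1 gtr0_norm// gtr_pMl.
exists ((s * r) *: 1), ((s * r) *: expI I third_turn), ((s * r) *: expI I (- third_turn)).
split; [by apply: inB; rewrite quat_norm1|by apply: inB; rewrite norm_expI//..|].
congr (_%:E); rewrite cbrtE ?(ltW sr0)//; congr (_ `^ _).
rewrite -!scalerBr !normrZ (gtr0_norm s0) (gtr0_norm r0).
have -> : max_triangle = `|vandermonde 1 (expI I third_turn) (expI I (- third_turn))|.
  have [_ nI] := (imag_unitP I).1 uI.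
  rewrite isosceles_vandermonde// normrZ nI mulr1 normrN third_turn_cos third_turn_sin.
  have -> : 4 * (1 - - 2^-1) * (Num.sqrt 3 / 2) = max_triangle.
    by rewrite /max_triangle; field.
  by rewrite gtr0_norm// max_triangle_gt0.
by rewrite /vandermonde !quat_normM; ring.
Qed.

Lemma cbrt_le x r : 0 <= x -> 0 <= r ->
  (x `^ 3^-1 <= r * max_triangle `^ 3^-1) = (x <= r ^+ 3 * max_triangle).
Proof.
move=> x0 r0; have M0 := ltW max_triangle_gt0; rewrite cbrtE//.
have rM0 : 0 <= r ^+ 3 * max_triangle by rewrite mulr_ge0// exprn_ge0.
apply/idP/idP => [|xr]; last by rewrite ge0_ler_powR ?nnegrE.
by apply: contraTT; rewrite -!ltNge => rx; rewrite gt0_ltr_powR ?nnegrE.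
Qed.

End ThreeDiameterBall.

(** * The cubic power series behind the slice 3-diameter *)

Lemma sum_nat_one_term (V : nmodType) n p (g : nat -> V) : (p < n)%N ->
  (forall k, (k < n)%N -> k != p -> g k = 0) -> \sum_(k < n) g k = g p.
Proof.
move=> pn g0; rewrite (bigD1 (Ordinal pn))//= big1 ?addr0// => k kp.
exact: g0.
Qed.

Lemma sum_nat_two_terms (V : nmodType) n p q (g : nat -> V) : p != q ->
  (p < n)%N -> (q < n)%N ->
  (forall k, (k < n)%N -> k != p -> k != q -> g k = 0) ->
  \sum_(k < n) g k = g p + g q.
Proof.
move=> pq pn qn g0; rewrite (bigD1 (Ordinal pn))//= (bigD1 (Ordinal qn))/=; last first.
  by rewrite -val_eqE/= eq_sym.
rewrite big1 ?addr0// => k /andP[kp kq]; exact: g0.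
Qed.

Section CubicSeries.
Variables (R : realType) (b : nat -> quat R) (w1 w2 w3 : quat R).

Definition cubic_term j l m : quat R :=
  (w2 ^+ j - w1 ^+ j) * (w3 ^+ l - w1 ^+ l) * (w3 ^+ m - w2 ^+ m)
  * b j * b l * b m.

Definition cubic_coef n : quat R :=
  \sum_(k < n.+1) \sum_(j < k.+1) cubic_term j (k - j) (n - k).

Lemma cubic_term0l l m : cubic_term 0 l m = 0.
Proof. by rewrite /cubic_term !expr0 subrr !mul0r. Qed.

Lemma cubic_term0m j m : cubic_term j 0 m = 0.
Proof. by rewrite /cubic_term !expr0 subrr mulr0 !mul0r. Qed.

Lemma cubic_term0r j l : cubic_term j l 0 = 0.
Proof. by rewrite /cubic_term !expr0 subrr mulr0 !mul0r. Qed.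

Lemma cubic_coef_lt3 n : (n < 3)%N -> cubic_coef n = 0.
Proof.
move=> n3; rewrite /cubic_coef; apply: big1 => k _; apply: big1 => j _.
case: k j => [k kn] [[|j] /= jk] /=; first by rewrite cubic_term0l.
have [->|kj] := eqVneq (k - j.+1)%N 0%N; first by rewrite cubic_term0m.
suff -> : (n - k = 0)%N by rewrite cubic_term0r.
by lia.
Qed.

(** Three positive indices with sum N + 2 that avoid 2, .., N - 1 are 1, 1 and N
    in some order. *)
Lemma cubic_coef_gap N : (1 < N)%N ->
  (forall i, (1 < i < N)%N -> b i = 0) ->
  cubic_coef N.+2 = cubic_term 1 1 N + (cubic_term 1 N 1 + cubic_term N 1 1).
Proof.
move=> N1 b0; have term0 j l m : (1 < j < N)%N || (1 < l < N)%N || (1 < m < N)%N ->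
    cubic_term j l m = 0.
  by rewrite /cubic_term => /orP[/orP[]|] /b0 ->; rewrite !(mulr0, mul0r).
rewrite /cubic_coef.
rewrite (@sum_nat_two_terms _ N.+3 2 N.+1
  (fun k => \sum_(j < k.+1) cubic_term j (k - j) (N.+2 - k)))//; first last.
- move=> k kN k2 kN1; apply: big1 => j _.
  have [->|m0] := eqVneq (N.+2 - k)%N 0%N; first by rewrite cubic_term0r.
  have [mN|Nm] := ltnP (N.+2 - k)%N N.
    by rewrite term0// mN; lia.
  case: j => -[|[|j]] /= jk; first by rewrite cubic_term0l.
    by rewrite (_ : k - 1 = 0)%N ?cubic_term0m//; lia.
  by lia.
- by lia.
congr (_ + _).
  rewrite (@sum_nat_one_term _ 3 1 (fun j => cubic_term j (2 - j) (N.+2 - 2)))//.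
    by congr cubic_term; lia.
  by move=> [|[|[|]]]// _ _; rewrite ?cubic_term0l ?cubic_term0m.
rewrite (@sum_nat_two_terms _ N.+2 1 N
  (fun j => cubic_term j (N.+1 - j) (N.+2 - N.+1)))//.
- have -> : (N.+1 - 1 = N)%N by lia.
  have -> : (N.+2 - N.+1 = 1)%N by lia.
  by have -> : (N.+1 - N = 1)%N by lia.
- by lia.
- move=> [|j] jN j1 jN1; first by rewrite cubic_term0l.
  have [->|l0] := eqVneq (N.+1 - j.+1)%N 0%N; first by rewrite cubic_term0m.
  by rewrite term0//; lia.
Qed.

Lemma cubic_coef3 : cubic_coef 3 = vandermonde w1 w2 w3 * b 1%N ^+ 3.
Proof.
rewrite /cubic_coef (@sum_nat_one_term _ 4 2
  (fun k => \sum_(j < k.+1) cubic_term j (k - j) (3 - k)))//.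
  rewrite (@sum_nat_one_term _ 3 1 (fun j => cubic_term j (2 - j) (3 - 2)))//.
    by rewrite /cubic_term /vandermonde !expr1 !exprS expr0 mulr1 !mulrA.
  by move=> [|[|[|]]]// _ _; rewrite ?cubic_term0l ?cubic_term0m.
move=> k k4 k2; apply: big1 => -[[|j] jk] _ /=; first by rewrite cubic_term0l.
move: k k4 k2 jk => [|[|[|[|]]]]// _ _ jk; last by rewrite cubic_term0r.
by case: j jk => // _; rewrite cubic_term0m.
Qed.

(** The at most (n + 1)^2 terms are absorbed by two of the three factors
    (1 + t)^n. *)
Lemma subgeometric_cubic : `|w1| <= 1 -> `|w2| <= 1 -> `|w3| <= 1 ->
  subgeometric b -> subgeometric cubic_coef.
Proof.
move=> w11 w21 w31 bg s s1.
pose t := Num.min 1 ((s - 1) / 7).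
have t0 : 0 < t by rewrite lt_min ltr01/= divr_gt0// subr_gt0.
have t1 : t <= 1 by rewrite ge_min lexx.
have ts : (1 + t) ^+ 3 <= s.
  have : t <= (s - 1) / 7 by rewrite ge_min lexx orbT.
  have -> : (1 + t) ^+ 3 = 1 + 3 * t + 3 * (t * t) + t * t * t by ring.
  have tt : t * t <= t by rewrite ler_piMr ?(ltW t0).
  have ttt : t * t * t <= t * t by rewrite ler_piMr// mulr_ge0 ?(ltW t0).
  by lra.
have t1' : 1 < 1 + t by rewrite ltrDl.
have [C bC] := bg _ t1'.
have C0 : 0 <= C by have := bC 0%N; rewrite expr0 mulr1; exact: le_trans.
have diff (w w' : quat R) j : `|w| <= 1 -> `|w'| <= 1 -> `|w ^+ j - w' ^+ j| <= 2.
  move=> wl wl'; apply: le_trans (ler_normB _ _) _; rewrite !quat_normX.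
  by rewrite (_ : 2 = 1 + 1)// lerD// exprn_ile1.
have termC j l m : `|cubic_term j l m| <= (2 * 2 * 2) * (C * C * C) * (1 + t) ^+ (j + l + m).
  rewrite /cubic_term !quat_normM !exprD.
  have -> : (2 * 2 * 2) * (C * C * C) * ((1 + t) ^+ j * (1 + t) ^+ l * (1 + t) ^+ m) =
    2 * 2 * 2 * (C * (1 + t) ^+ j) * (C * (1 + t) ^+ l) * (C * (1 + t) ^+ m) by ring.
  by rewrite !ler_pM ?mulr_ge0//; apply: diff.
have lin n : n.+1%:R <= t^-1 * (1 + t) ^+ n.
  rewrite ler_pdivlMl//; apply: le_trans (bernoulli_ge n (ltW t0)).
  by rewrite -natr1 mulrDr mulr1 addrC mulrC lerD2r.
exists (8 * (C * C * C) * t^-1 ^+ 2) => n.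
have coefC : `|cubic_coef n| <= n.+1%:R * (n.+1%:R * (8 * (C * C * C) * (1 + t) ^+ n)).
  have E0 : 0 <= 8 * (C * C * C) * (1 + t) ^+ n.
    by rewrite !mulr_ge0// exprn_ge0// addr_ge0// ltW.
  have sumle m (g : 'I_m -> quat R) (B : R) :
      (forall i, `|g i| <= B) -> `|\sum_i g i| <= m%:R * B.
    move=> gB; apply: le_trans (ler_norm_sum _ _ _) _.
    apply: le_trans (ler_sum _ (fun i _ => gB i)) _.
    by rewrite sumr_const card_ord -[_ *+ m]mulr_natl.
  apply: (sumle) => k; apply: le_trans (sumle _ _ (8 * (C * C * C) * (1 + t) ^+ n) _) _.
    move=> j; apply: le_trans (termC _ _ _) _.
    rewrite -!natrM (_ : j + (k - j) + (n - k) = n)%N//.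
    by have := ltn_ord j; have := ltn_ord k; lia.
  by rewrite ler_wpM2r// ler_nat.
apply: le_trans coefC _; have p0 : 0 <= (1 + t) ^+ n.
  by rewrite exprn_ge0// addr_ge0// ltW.
have D0 : 0 <= 8 * (C * C * C) * (1 + t) ^+ n by rewrite !mulr_ge0.
apply: (@le_trans _ _ ((t^-1 * (1 + t) ^+ n) * ((t^-1 * (1 + t) ^+ n) *
    (8 * (C * C * C) * (1 + t) ^+ n)))).
  by rewrite !ler_pM// ?mulr_ge0.
have -> : (t^-1 * (1 + t) ^+ n) * ((t^-1 * (1 + t) ^+ n) *
    (8 * (C * C * C) * (1 + t) ^+ n)) =
    8 * (C * C * C) * t^-1 ^+ 2 * ((1 + t) ^+ 3) ^+ n.
  by rewrite -exprM mulnC exprM; ring.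
rewrite ler_wpM2l ?mulr_ge0 ?exprn_ge0 ?invr_ge0 ?(ltW t0)//.
by rewrite lerXn2r ?nnegrE ?exprn_ge0 ?addr_ge0 ?(ltW t0)// ltW// (lt_trans _ s1).
Qed.

End CubicSeries.

Section SliceDiameter.
Variables (R : realType) (f : quat R -> quat R).
Hypothesis fr : slice_regular f.
Let b := normalized_coefs f.

Lemma normalized_coefsE : exists v, forall n, b n = coefs f n * v /\
  `|b n| = `|coefs f n|.
Proof.
rewrite /b /normalized_coefs; case: pselect => [ex|nex].
  set aN := coefs f _; have aN0 : aN != 0 by rewrite /aN; case: ex_minnP.
  exists (`|aN| *: aN^-1) => n; split; first by rewrite scalerAr.
  by rewrite normrZ quat_normM quat_normV normr_id mulrCA divff ?mulr1 ?normr_eq0.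
exists 0 => n; rewrite mulr0; split=> //.
suff -> : coefs f n = 0 by [].
by apply/eqP/negP => /negP an; apply: nex; exists n.
Qed.

Lemma normalized_coefs_subgeometric : subgeometric b.
Proof.
have [v bE] := normalized_coefsE; rewrite (_ : b = fun n => coefs f n * v).
  by apply: subgeometricMr; exact: coefs_subgeometric.
by apply/funext => n; have [] := bE n.
Qed.

Lemma norm_normalized_coefs n : `|b n| = `|coefs f n|.
Proof. by have [v /(_ n)[]] := normalized_coefsE. Qed.

Lemma ghatE w1 w2 w3 z : ghat f w1 w2 w3 z = psum (cubic_coef b w1 w2 w3) z.
Proof. by []. Qed.

(** The quotient of [ghat] by the cube of its variable. *)
Definition reduced_coef w1 w2 w3 n : quat R := cubic_coef b w1 w2 w3 (n + 3).

Lemma reduced_subgeometric w1 w2 w3 :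
  `|w1| <= 1 -> `|w2| <= 1 -> `|w3| <= 1 ->
  subgeometric (reduced_coef w1 w2 w3).
Proof.
move=> w11 w21 w31; apply: subgeometric_shift; apply: subgeometric_cubic => //.
exact: normalized_coefs_subgeometric.
Qed.

Lemma ghat_reduced w1 w2 w3 z :
  `|w1| <= 1 -> `|w2| <= 1 -> `|w3| <= 1 -> `|z| < 1 ->
  ghat f w1 w2 w3 z = z ^+ 3 * psum (reduced_coef w1 w2 w3) z.
Proof.
move=> w11 w21 w31 z1; rewrite ghatE; apply: psum_shift => //.
  by apply: subgeometric_cubic => //; exact: normalized_coefs_subgeometric.
by move=> n n3; exact: cubic_coef_lt3.
Qed.

Lemma slice_d3_ball_nondecreasing :
  {homo slice_d3_ball f : r r' / (r <= r')%R >-> (r <= r')%E}.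
Proof.
move=> r r' rr'; apply: ereal_sup_le => x [I [w1 [w2 [w3 [z [uI w [zr zI] ->]]]]]].
exists I, w1, w2, w3, z; split=> //; split=> //; exact: le_trans rr'.
Qed.

Lemma slice_d3_ball_le_slice_d3 r : r < 1 -> (slice_d3_ball f r <= slice_d3 f)%E.
Proof.
by apply: nondecreasing_le_lim_left; exact: slice_d3_ball_nondecreasing.
Qed.

End SliceDiameter.

(** * Rigidity in the extremal case *)

Section FirstOrder.
Variable R : realType.
Implicit Types (D g : R -> R) (y C M t : R).

(** At t0 the bounds give y D t0 = 0. If D t0 = 0, then C (M - g) - y D and
    C (M - g) + y D are nonnegative and vanish at t0, so that their derivatives
    vanish there and y dD = 0. *)
Lemma squeezed_first_order D g (t0 dD dg y C M : R) :
  is_derive t0 1 D dD -> is_derive t0 1 g dg ->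
  (forall t, derivable D t 1) -> (forall t, derivable g t 1) ->
  (forall t, y * D t <= C * (M - g t)) ->
  (forall t, - (y * D t) <= C * (M - g t)) ->
  g t0 = M -> D t0 != 0 \/ dD != 0 -> y = 0.
Proof.
move=> Dd gd Dder gder le1 le2 gM.
have yD0 : y * D t0 = 0.
  by have := le1 t0; have := le2 t0; rewrite gM subrr mulr0 => ? ?; lra.
case=> [D0|dD0].
  by move/eqP: yD0; rewrite mulf_eq0 (negbTE D0) orbF => /eqP.
have crit (s : R) : (forall t, s * D t <= C * (M - g t)) -> s * D t0 = 0 ->
    C * dg + s * dD = 0.
  move=> les s0; pose phi t := C * g t + s * D t.
  have phid : is_derive t0 1 phi (C * dg + s * dD).
    rewrite /phi; apply: (@is_deriveD _ _ _ (fun t => C * g t) (fun t => s * D t));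
    exact: is_deriveZ.
  have phider t : derivable phi t 1.
    by apply: derivableD; apply: derivableZ.
  have := @derive1_at_max R phi (t0 - 1) (t0 + 1) t0.
  move=> /(_ _ _ _ _)[||||_ dphi]; first by lra.
  - by move=> t _; exact: phider.
  - by rewrite in_itv/=; apply/andP; split; lra.
  - by move=> t _; have := les t; rewrite /phi s0 gM; lra.
  by have [_ <-] := phid; rewrite dphi.
have e1 := crit y le1 yD0.
have e2 := crit (- y) (fun t => ltac:(by rewrite mulNr; exact: le2)) ltac:(by rewrite mulNr yD0 oppr0).
have : y * dD = 0 by lra.
by move/eqP; rewrite mulf_eq0 (negbTE dD0) orbF => /eqP.
Qed.

End FirstOrder.

Section TriangleDerivatives.
Variables (R : realType) (k : nat).
Implicit Types t : R.

(** The product of the sides of the triangle (1, x, 1/x), with x = exp(I t) and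
    up to the sign of sin t. *)
Definition side_product t : R := 4 * (1 - cos t) * sin t.

(** Real and imaginary parts of (x^k - 1) (1/x - 1) for x = cos t + I sin t. *)
Definition re_part t : R :=
  (cos (k%:R * t) - 1) * (cos t - 1) + sin (k%:R * t) * sin t.
Definition im_part t : R :=
  sin (k%:R * t) * (cos t - 1) - (cos (k%:R * t) - 1) * sin t.

(** The k-dependence of the coefficient of degree k + 2 at (1, x, 1/x): the skew
    part is what changes under the exchange of x and 1/x, the symmetric part is
    the common factor once b_k commutes with b_1. *)
Definition skew_part t : R := sin t * im_part t.
Definition sym_part t : R := sin t * re_part t + (1 - cos t) * sin (k%:R * t).

Lemma is_derive_mulk t : is_derive t 1 (fun s : R => k%:R * s) k%:R.
Proof. by apply: is_derive_eq; rewrite /GRing.scale/= mulr1. Qed.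

#[local] Instance is_derive_sin_mul t :
  is_derive t 1 (fun s => sin (k%:R * s)) (k%:R * cos (k%:R * t)).
Proof.
have d := is_derive1_comp (is_derive_sin (k%:R * t)) (is_derive_mulk t).
by apply: (is_derive_eq d); rewrite mulrC.
Qed.

#[local] Instance is_derive_cos_mul t :
  is_derive t 1 (fun s => cos (k%:R * s)) (- (k%:R * sin (k%:R * t))).
Proof.
have d := is_derive1_comp (is_derive_cos (k%:R * t)) (is_derive_mulk t).
by apply: (is_derive_eq d); rewrite mulNr mulrC.
Qed.

Lemma is_derive_side_product t :
  is_derive t 1 side_product (4 * (sin t * sin t + (1 - cos t) * cos t)).
Proof.
rewrite /side_product; apply: is_derive_eq.
rewrite /GRing.scale/=; ring.
Qed.

Lemma is_derive_skew t : is_derive t 1 skew_part (cos t * im_part t +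
  sin t * (k%:R * cos (k%:R * t) * (cos t - 1) - sin (k%:R * t) * sin t
    + k%:R * sin (k%:R * t) * sin t - (cos (k%:R * t) - 1) * cos t)).
Proof.
rewrite /skew_part /im_part; apply: is_derive_eq.
rewrite /GRing.scale/=; ring.
Qed.

Lemma is_derive_sym t : is_derive t 1 sym_part (cos t * re_part t +
  sin t * (- (k%:R * sin (k%:R * t)) * (cos t - 1) - (cos (k%:R * t) - 1) * sin t
    + k%:R * cos (k%:R * t) * sin t + sin (k%:R * t) * cos t)
  + sin t * sin (k%:R * t) + (1 - cos t) * (k%:R * cos (k%:R * t))).
Proof.
rewrite /sym_part /re_part; apply: is_derive_eq.
rewrite /GRing.scale/=; ring.
Qed.

End TriangleDerivatives.

Section Tangency.
Variables (R : realType) (k : nat).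
Hypothesis k1 : (1 < k)%N.

Let k0 : 0 < k%:R :> R. Proof. by rewrite ltr0n (ltn_trans _ k1). Qed.
Let k1' : 1 < k%:R :> R. Proof. by rewrite ltr1n. Qed.

Lemma side_product_third_turn : side_product (third_turn R) = max_triangle R.
Proof.
by rewrite /side_product third_turn_cos third_turn_sin /max_triangle; lra.
Qed.

(** The three cases are the residues of k modulo 3: either the skew part itself
    or its derivative is nonzero at the equilateral triangle. *)
Lemma skew_tangent y C :
  (forall t, y * skew_part k t <= C * (max_triangle R - side_product t)) ->
  (forall t, - (y * skew_part k t) <= C * (max_triangle R - side_product t)) -> y = 0.
Proof.
move=> le1 le2.
apply: (squeezed_first_order (is_derive_skew k (third_turn R))
  (is_derive_side_product (third_turn R)) _ _ le1 le2 side_product_third_turn) => [t|t|].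
- exact: (@ex_derive _ _ _ _ _ _ _ (is_derive_skew k t)).
- exact: (@ex_derive _ _ _ _ _ _ _ (is_derive_side_product t)).
rewrite /skew_part /im_part third_turn_cos.
have s0 := third_turn_sin_gt0 R; have ss := third_turn_sin_sqr R.
have := third_turn_mul R k; set s := sin (third_turn R) in s0 ss *.
move=> /= [[-> ->]|[-> ->]|[-> ->]]; [right|right|left].
- rewrite (_ : _ + _ = s * (- (3 / 2 * k%:R))); last by field.
  by rewrite lt_eqF// pmulr_rlt0//; have := k0; lra.
- rewrite (_ : _ + _ = s * (3 / 4 * k%:R - 3 / 4 + (k%:R - 1) * (s * s)))//; last by field.
  by rewrite ss gt_eqF// pmulr_rgt0//; have := k1'; lra.
- rewrite (_ : _ * _ = 3 * (s * s)); last by field.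
  by rewrite ss gt_eqF//; lra.
Qed.

Lemma sym_tangent y C :
  (forall t, y * sym_part k t <= C * (max_triangle R - side_product t)) ->
  (forall t, - (y * sym_part k t) <= C * (max_triangle R - side_product t)) -> y = 0.
Proof.
move=> le1 le2.
apply: (squeezed_first_order (is_derive_sym k (third_turn R))
  (is_derive_side_product (third_turn R)) _ _ le1 le2 side_product_third_turn) => [t|t|].
- exact: (@ex_derive _ _ _ _ _ _ _ (is_derive_sym k t)).
- exact: (@ex_derive _ _ _ _ _ _ _ (is_derive_side_product t)).
rewrite /sym_part /re_part third_turn_cos.
have s0 := third_turn_sin_gt0 R; have ss := third_turn_sin_sqr R.
have := third_turn_mul R k; set s := sin (third_turn R) in s0 ss *.
move=> /= [[-> ->]|[-> ->]|[-> ->]]; [right|left|right].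
- rewrite (_ : _ + _ = k%:R * (s * s) + 3 / 2 * k%:R); last by field.
  by rewrite ss gt_eqF//; have := k0; lra.
- rewrite (_ : _ + _ = s * (15 / 4 + s * s)); last by field.
  by rewrite ss gt_eqF// mulr_gt0//; lra.
- rewrite (_ : _ + _ = - (9 / 8) - 3 / 4 * k%:R + (s * s) * (3 / 2 - 2 * k%:R)); last by field.
  by rewrite ss lt_eqF//; have := k1'; lra.
Qed.

End Tangency.

Section Rigidity.
Variables (R : realType) (b : nat -> quat R).
Implicit Types (I : quat R) (s t : R).
Hypothesis bg : subgeometric b.
Hypothesis bounded : forall I w1 w2 w3 z, imag_units I ->
  slice_cball I 1 w1 -> slice_cball I 1 w2 -> slice_cball I 1 w3 ->
  slice_plane I z -> `|z| < 1 ->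
  `|psum (fun n => cubic_coef b w1 w2 w3 (n + 3)) z| <= max_triangle R.
Hypothesis b1 : `|b 1%N| = 1.

Let u := b 1%N.
Let u_unit : u \is a GRing.unit.
Proof. by rewrite quat_unitE -normr_eq0 b1 oner_eq0. Qed.

(** [beta] and its conjugates by b_1 are what remains of b_k in the three terms
    of the coefficient of degree k + 2. *)
Let beta k := b k * u^-1.

Definition root_factor I k t : quat R := (re_part k t)%:A + im_part k t *: I.

(** Caratheodory's inequality for the coefficient of degree k + 2 of the cubic
    series of (1, x, 1/x). The factors I on the left and b_1^-3 on the right
    turn its leading coefficient into the real number [side_product t]. *)
Lemma coefficient_inequality I k s t : imag_units I -> (1 < k)%N ->
  (forall i, (1 < i < k)%N -> b i = 0) ->
  qre (expI I s * ((2 * sin t) *: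
       (root_factor I k t * beta k + root_factor (- I) k t * (u * beta k / u)) +
     (4 * (1 - cos t) * sin (k%:R * t)) *: (u ^+ 2 * beta k / u ^+ 2))) <=
  2 ^+ k * (max_triangle R - side_product t).
Proof.
move=> uI k1 b0.
set A := root_factor I k t; set A' := root_factor (- I) k t.
pose w2 := expI I t; pose w3 := expI I (- t).
have K1 : slice_cball I 1 1 by split; [rewrite /= quat_norm1|exact: in_plane1].
have KE x : slice_cball I 1 (expI I x).
  by split; [rewrite /= norm_expI|exact: expI_in_plane].
have II := imag_unit_sqr uI.
have [_ nI] := (imag_unitP I).1 uI.
have II' : slice_plane I I by exists 0, 1; rewrite scale0r add0r scale1r.
have nw x : `|expI I x| <= 1 by rewrite norm_expI.
pose e n := cubic_coef b 1 w2 w3 (n + 3).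
have eg : subgeometric e.
  by apply: subgeometric_shift; apply: subgeometric_cubic => //; rewrite ?quat_norm1 ?nw.
have nu3 : `|u^-1 ^+ 3| = 1 by rewrite quat_normX quat_normV b1 invr1 expr1n.
have k0 : (0 < k.-1)%N by lia.
have := caratheodory_norm uI eg s k0 II' nI nu3
  (fun z zI z1 => bounded uI K1 (KE t) (KE (- t)) zI z1).
have -> : I * e 0%N * u^-1 ^+ 3 = (side_product t)%:A.
  rewrite /e add0n cubic_coef3 isosceles_vandermonde// -/u.
  rewrite mulrA -[I * _ * _ * _]mulrA exprVn divrr ?unitrX// mulr1.
  by rewrite -scalerAr II scalerN scaleNr opprK.
have -> : 2 ^+ k.-1 * (2 * (max_triangle R - qre (side_product t)%:A)) =
    2 ^+ k * (max_triangle R - side_product t).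
  rewrite qreZ mulr1 mulrA -exprSr (_ : k.-1.+1 = k)//; lia.
suff -> : (2 * sin t) *: (A * beta k + A' * (u * beta k / u)) +
    (4 * (1 - cos t) * sin (k%:R * t)) *: (u ^+ 2 * beta k / u ^+ 2) =
    I * e k.-1 * u^-1 ^+ 3 by rewrite !mulrA.
rewrite /e (_ : k.-1 + 3 = k.+2)%N; last by lia.
rewrite cubic_coef_gap// /cubic_term !expr1 -/u.
have F1 : I * ((w2 ^+ k - 1 ^+ k) * (w3 - 1) * (w3 - w2)) = (2 * sin t) *: A.
  rewrite expr1n /w2 /w3 expIX// (expI_sub1 I (k%:R * t)) (expIN_sub1 I t) expIN_sub_expI.
  rewrite plane_triple// mulrDr -!scalerAr mulr1 II /A /root_factor /re_part /im_part.
  by rewrite scalerN scalerDr !scalerA addrC -scaleNr; congr (_ *: _ + _ *: _); ring.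
have F2 : I * ((w2 - 1) * (w3 ^+ k - 1 ^+ k) * (w3 - w2)) = (2 * sin t) *: A'.
  rewrite expr1n /w2 /w3 expIX// mulrN (expI_sub1 I t) (expIN_sub1 I (k%:R * t)) expIN_sub_expI.
  rewrite plane_triple// mulrDr -!scalerAr mulr1 II /A' /root_factor /re_part /im_part.
  by rewrite !scalerN scalerBr !scalerA addrC -[- (_ *: 1)]scaleNr -[- (_ *: I)]scaleNr;
    congr (_ *: _ + _ *: _); ring.
have F3 : I * ((w2 - 1) * (w3 - 1) * (w3 ^+ k - w2 ^+ k)) =
    (4 * (1 - cos t) * sin (k%:R * t))%:A.
  rewrite /w2 /w3 !expIX// mulrN (expI_sub1 I t) (expIN_sub1 I t) expIN_sub_expI.
  rewrite plane_triple// mulrDr -!scalerAr mulr1 II scalerN -scaleNr.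
  rewrite -[RHS]add0r; congr (_ + _).
    have cs := cos2Dsin2 t; move: cs; rewrite !expr2 => cs.
    rewrite (_ : _ + _ = 0) ?scale0r//; ring.
  congr (_ *: _); have := cos2Dsin2 t; rewrite !expr2 => cs.
  have ss : sin t * sin t = 1 - cos t * cos t by lra.
  transitivity (2 * sin (k%:R * t) * ((cos t - 1) * (cos t - 1) + sin t * sin t)).
    by ring.
  by rewrite ss; ring.
have E1 : b k * u * u * u^-1 ^+ 3 = beta k.
  by rewrite /beta !exprS expr0 mulr1 !mulrA !mulrK.
have E2 : u * b k * u * u^-1 ^+ 3 = u * beta k / u.
  by rewrite /beta !exprS expr0 mulr1 !mulrA mulrK.
have E3 : u * u * b k * u^-1 ^+ 3 = u ^+ 2 * beta k / u ^+ 2.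
  by rewrite /beta !exprS expr0 !mulr1 !mulrA invrM// !mulrA.
have regroup (X p q r : quat R) :
    I * (X * p * q * r) * u^-1 ^+ 3 = (I * X) * (p * q * r * u^-1 ^+ 3).
  by rewrite !mulrA.
have distribute (x y z v : quat R) :
    I * (x + (y + z)) * v = I * x * v + (I * y * v + I * z * v).
  by rewrite !(mulrDr, mulrDl).
rewrite distribute !regroup F1 F2 F3 E1 E2 E3.
rewrite scalerDr -[_%:A * _]scalerAl mul1r -[_ *: A' * _]scalerAl -[_ *: A * _]scalerAl.
by rewrite [LHS]addrC; congr (_ + _); rewrite addrC.
Qed.

(** Near the equilateral triangle the slack in the coefficient inequality is of
    second order, so that the coefficient must vanish there together with its
    first variation. Comparison with the triangle whose last two vertices are
    exchanged shows that [beta k] equals its conjugates by b_1; what remains is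
    [beta k] times a real factor with a nonzero value or a nonzero derivative. *)
Lemma next_coefficient_eq0 k : (1 < k)%N ->
  (forall i, (1 < i < k)%N -> b i = 0) -> b k = 0.
Proof.
move=> k1 b0.
pose p := beta k; pose p' := u * p / u; pose p'' := u ^+ 2 * p / u ^+ 2.
have ineq I s t (uI : imag_units I) := coefficient_inequality s t uI k1 b0.
pose S I t := (2 * sin t) *: (root_factor I k t * p + root_factor (- I) k t * p')
  + (4 * (1 - cos t) * sin (k%:R * t)) *: p''.
(* Turning s by pi reverses the sign; replacing I by -I exchanges x and 1/x. *)
have {}ineq I s t : imag_units I ->
    qre (expI I s * S I t) <= 2 ^+ k * (max_triangle R - side_product t).
  by move=> uI; exact: ineq.
have ineqN I s t : imag_units I ->
    - qre (expI I s * S I t) <= 2 ^+ k * (max_triangle R - side_product t).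
  move=> uI; have := ineq I (s + pi) t uI.
  by rewrite expI_addpi mulNr.
have swap I s t : imag_units I ->
    qre (expI I s * S (- I) t) <= 2 ^+ k * (max_triangle R - side_product t).
  move=> uI; have := ineq (- I) (- s) t (imag_unitsN uI).
  by rewrite -expI_opp opprK.
have SB I t : S I t - S (- I) t = (4 * skew_part k t) *: (I * (p - p')).
  rewrite /S opprK [X in _ - X]addrC opprD addrA addrK -scalerBr.
  have -> : root_factor I k t * p + root_factor (- I) k t * p' -
      (root_factor (- I) k t * p + root_factor I k t * p') =
      (root_factor I k t - root_factor (- I) k t) * (p - p').
    rewrite mulrBl !mulrBr opprB opprD -!addrA; congr (_ + _).
    by rewrite addrA addrC.
  have -> : root_factor I k t - root_factor (- I) k t = (2 * im_part k t) *: I.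
    rewrite /root_factor scalerN opprB addrA addrAC [_%:A + _]addrC addrK.
    by rewrite -scalerDl; congr (_ *: _); ring.
  by rewrite -scalerAl scalerA; congr (_ *: _); rewrite /skew_part; ring.
have pp' : p = p'.
  apply/eqP; rewrite -subr_eq0; apply/eqP/quat_eq0_slices => I s uI.
  (* The factor I in SB is absorbed into the angle. *)
  have half : expI I s = expI I (s - pi / 2) * I.
    have E : expI I (pi / 2) = I.
      by rewrite /expI cos_pihalf sin_pihalf scale0r add0r scale1r.
    by rewrite -[X in _ * X]E -expID// subrK.
  rewrite half -mulrA; apply: (@skew_tangent _ k k1 _ (2 ^+ k / 2)) => t.
    have := ineqN (- I) (- (s - pi / 2)) t (imag_unitsN uI).
    rewrite -expI_opp opprK; have := ineq I (s - pi / 2) t uI.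
    have -> : qre (expI I (s - pi / 2) * (I * (p - p'))) * skew_part k t =
      4^-1 * (qre (expI I (s - pi / 2) * S I t) - qre (expI I (s - pi / 2) * S (- I) t)).
      by rewrite -qreB -mulrBr SB -[expI _ _ * (_ *: _)]scalerAr qreZ; field.
    by lra.
  have := swap I (s - pi / 2) t uI; have := ineqN I (s - pi / 2) t uI.
  have -> : qre (expI I (s - pi / 2) * (I * (p - p'))) * skew_part k t =
    4^-1 * (qre (expI I (s - pi / 2) * S I t) - qre (expI I (s - pi / 2) * S (- I) t)).
    by rewrite -qreB -mulrBr SB -[expI _ _ * (_ *: _)]scalerAr qreZ; field.
  by lra.
have up : u * p = p * u by rewrite {2}pp' /p' mulrVK.
have pp'' : p'' = p.
  have -> : p'' = p * u ^+ 2 / u ^+ 2 by rewrite (commrX 2 (esym up)).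
  by rewrite mulrK// unitrX.
have SE I t : S I t = (4 * sym_part k t) *: p.
  rewrite /S -pp' pp'' -mulrDl /root_factor scalerN addrACA subrr addr0.
  rewrite -scalerDl -scalerAl mul1r scalerA -scalerDl.
  by congr (_ *: _); rewrite /sym_part; ring.
have p0 : p = 0.
  apply/quat_eq0_slices => I s uI.
  apply: (@sym_tangent _ k k1 _ (2 ^+ k / 4)) => t.
    have := ineq I s t uI; rewrite SE -[expI _ _ * _]scalerAr qreZ.
    by lra.
  have := ineqN I s t uI; rewrite SE -[expI _ _ * _]scalerAr qreZ.
  by lra.
by have := p0; rewrite /p /beta => /(congr1 ( *%R^~ u)); rewrite mulrVK// mul0r.
Qed.

Lemma coefficients_eq0 k : (1 < k)%N -> b k = 0.
Proof.
elim/ltn_ind: k => k IHk k1; apply: next_coefficient_eq0 => // i /andP[i1 ik].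
exact: IHk.
Qed.

End Rigidity.

(** * Schwarz's lemma for the slice 3-diameter *)

Section Extremal.
Variables (R : realType) (f : quat R -> quat R).
Hypotheses (f_regular : slice_regular f) (f_diam : slice_d3 f = d3 (qball 1)).
Implicit Types (I w z : quat R) (r : R).
Let b := normalized_coefs f.
Let M := max_triangle R.
Let M0 : 0 < M. Proof. exact: max_triangle_gt0. Qed.

Lemma ghat_le_max_triangle I w1 w2 w3 z : imag_units I ->
  slice_cball I 1 w1 -> slice_cball I 1 w2 -> slice_cball I 1 w3 ->
  slice_plane I z -> `|z| < 1 -> `|ghat f w1 w2 w3 z| <= M.
Proof.
move=> uI K1 K2 K3 zI z1.
have := slice_d3_ball_le_slice_d3 f z1; rewrite f_diam d3_qball//.
suff : ((`|ghat f w1 w2 w3 z| `^ 3^-1)%:E <= slice_d3_ball f `|z|)%E.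
  move=> /le_trans /[apply]; rewrite lee_fin cbrt_le//.
  by rewrite expr1n mul1r.
by apply: ereal_sup_ubound; exists I, w1, w2, w3, z; split=> //; split=> /=.
Qed.

Lemma reduced_le_max_triangle I w1 w2 w3 z : imag_units I ->
  slice_cball I 1 w1 -> slice_cball I 1 w2 -> slice_cball I 1 w3 ->
  slice_plane I z -> `|z| < 1 -> `|psum (reduced_coef f w1 w2 w3) z| <= M.
Proof.
move=> uI K1 K2 K3; have /= n1 := K1.1; have /= n2 := K2.1; have /= n3 := K3.1.
apply: (schwarz3 uI); [by apply: reduced_subgeometric|exact: ltW|].
move=> w wI wl; rewrite -ghat_reduced//; exact: (ghat_le_max_triangle uI).
Qed.

Lemma reduced_coef0 w1 w2 w3 :
  reduced_coef f w1 w2 w3 0 = vandermonde w1 w2 w3 * b 1%N ^+ 3.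
Proof. by rewrite /reduced_coef add0n cubic_coef3. Qed.

Lemma slice_d3_ball_le r : 0 < r < 1 -> (slice_d3_ball f r <= d3 (qball r))%E.
Proof.
move=> /andP[r0 r1]; rewrite d3_qball//; apply: ge_ereal_sup => x.
move=> [I [w1 [w2 [w3 [z [uI [K1 K2 K3] zK ->]]]]]].
have /= zr := zK.1; have zI := zK.2.
have /= n1 := K1.1; have /= n2 := K2.1; have /= n3 := K3.1.
have z1 : `|z| < 1 by exact: le_lt_trans r1.
rewrite lee_fin cbrt_le ?(ltW r0)// ghat_reduced// quat_normM quat_normX.
by rewrite ler_pM ?exprn_ge0 ?lerXn2r ?nnegrE ?(ltW r0)// (reduced_le_max_triangle uI).
Qed.

(** At the centre and for the equilateral triangle the bound of Schwarz's lemma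
    reads M |b_1|^3 <= M. *)
Lemma norm_b1_le1 : `|b 1%N| <= 1.
Proof.
have [I uI _] := in_some_slice (0 : quat R).
have K1 : slice_cball I 1 1 by split; [rewrite /= quat_norm1|exact: in_plane1].
have KE x : slice_cball I 1 (expI I x).
  by split; [rewrite /= norm_expI|exact: expI_in_plane].
have z0I : slice_plane I 0 by exists 0, 0; rewrite !scale0r addr0.
have := @reduced_le_max_triangle I 1 (expI I (third_turn R))
  (expI I (- third_turn R)) 0 uI K1 (KE _) (KE _) z0I.
rewrite psum0 normr0 ltr01 reduced_coef0 isosceles_vandermonde// -/(side_product _).
rewrite side_product_third_turn quat_normM normrZ normrN gtr0_norm// quat_normX.
have [_ ->] := (imag_unitP I).1 uI; rewrite mulr1 => /(_ isT).
by rewrite -ler_pdivlMl// mulVf ?gt_eqF// expr_le1.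
Qed.

(** If |b_1| < 1, the values of the reduced series at the centre stay away from
    the bound M, uniformly in the triangle, and Harnack's inequality keeps them
    away on smaller discs. *)
Lemma slice_d3_ball_lt r : 0 < r < 1 -> `|b 1%N| < 1 ->
  (slice_d3_ball f r < d3 (qball r))%E.
Proof.
move=> /andP[r0 r1] b1; pose rho := (1 + r) / 2.
have rrho : r < rho by rewrite /rho; lra.
have rho1 : rho < 1 by rewrite /rho; lra.
have rho0 : 0 < rho by exact: lt_trans rrho.
pose c := (1 - r / rho) / (1 + r / rho); pose d := 1 - `|b 1%N| ^+ 3.
have x1 : r / rho < 1 by rewrite ltr_pdivrMr// mul1r.
have x0 : 0 < r / rho by rewrite divr_gt0.
have c0 : 0 < c by rewrite divr_gt0 ?subr_gt0// addr_gt0.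
have c1 : c < 1 by rewrite ltr_pdivrMr ?addr_gt0//; lra.
have d0 : 0 < d by rewrite subr_gt0 exprn_ilt1.
have d1 : d <= 1 by rewrite gerBl exprn_ge0.
have cd : 0 < c * d by rewrite mulr_gt0.
have cd1 : c * d < 1 by apply: le_lt_trans c1; rewrite ler_piMr// ltW.
pose M' := M * (1 - c * d).
have M'0 : 0 <= M' by rewrite mulr_ge0 ?(ltW M0)// subr_ge0 ltW.
have M'M : M' < M by rewrite gtr_pMr// gtrBl.
apply: (@le_lt_trans _ _ ((r ^+ 3 * M') `^ 3^-1)%:E); last first.
  rewrite d3_qball// lte_fin cbrtE ?(ltW r0)//.
  have r3 : 0 < r ^+ 3 by rewrite exprn_gt0.
  apply: gt0_ltr_powR; rewrite ?nnegrE ?invr_gt0//.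
  - by rewrite mulr_ge0// ltW.
  - by rewrite mulr_ge0// ltW// max_triangle_gt0.
  - by rewrite ltr_pM2l.
apply: ge_ereal_sup => x.
move=> [I [w1 [w2 [w3 [z [uI [K1 K2 K3] zK ->]]]]]].
have /= zr := zK.1; have zI := zK.2.
have /= n1 := K1.1; have /= n2 := K2.1; have /= n3 := K3.1.
have z1 : `|z| < 1 by exact: le_lt_trans r1.
have zrho : `|z| < rho by exact: le_lt_trans rrho.
rewrite lee_fin; apply: ge0_ler_powR; rewrite ?nnegrE ?invr_ge0//.
  by rewrite mulr_ge0// exprn_ge0// ltW.
rewrite ghat_reduced// quat_normM quat_normX.
rewrite ler_pM ?exprn_ge0 ?lerXn2r ?nnegrE ?(ltW r0)//.
have [|e0M] := harnack_norm (M := M) uI (reduced_subgeometric f_regular n1 n2 n3)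
    zI zrho rho1.
  by move=> w wI wl; apply: (reduced_le_max_triangle uI) => //; rewrite wl.
move=> /le_trans; apply.
have e0 : `|reduced_coef f w1 w2 w3 0| <= M * `|b 1%N| ^+ 3.
  rewrite reduced_coef0 quat_normM quat_normX ler_wpM2r ?exprn_ge0//.
  rewrite /vandermonde !quat_normM; have := triangle_le n1 n2 n3.
  by rewrite expr1n mul1r.
have cz : c <= (1 - `|z| / rho) / (1 + `|z| / rho).
  have zr' : `|z| / rho <= r / rho by rewrite ler_pM2r ?invr_gt0.
  have z0 : 0 <= `|z| / rho by rewrite divr_ge0// ltW.
  rewrite ler_pM ?invr_ge0 ?subr_ge0 ?addr_ge0 ?(ltW x1) ?(ltW x0)//; first by lra.
  by rewrite lef_pV2 ?posrE; lra.
have Md : M * d <= M - `|reduced_coef f w1 w2 w3 0|.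
  by rewrite /d mulrBr mulr1; lra.
have := ler_pM (ltW c0) (mulr_ge0 (ltW M0) (ltW d0)) cz Md.
rewrite (_ : c * (M * d) = M * (c * d)); last by ring.
by rewrite /M' mulrBr mulr1; lra.
Qed.

Lemma affine_of_norm_b1 : `|b 1%N| = 1 ->
  forall q, `|q| < 1 -> f q = coefs f 0 + q * coefs f 1.
Proof.
move=> b1 q q1; have bg := normalized_coefs_subgeometric f_regular.
have bk k : (1 < k)%N -> b k = 0.
  apply: (coefficients_eq0 bg _ b1) => I w1 w2 w3 z uI K1 K2 K3 zI z1.
  exact: (reduced_le_max_triangle uI).
have ak k : (1 < k)%N -> coefs f k = 0.
  move=> /bk bk0; apply/eqP.
  by rewrite -normr_eq0 -norm_normalized_coefs -/b bk0 normr0.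
have q01 : 0 <= `|q| < 1 by rewrite normr_ge0.
have [C [y [y01 _ /(_ q (lexx _))[_ tail]]]] :=
  psum_geometric (coefs_subgeometric f_regular) q01.
rewrite -psum_coefs//; apply: (eq_geometric_error (C := C) (N0 := 2) y01) => N N2.
suff <- : \sum_(n < N) q ^+ n * coefs f n = coefs f 0 + q * coefs f 1 by [].
rewrite -(subnKC N2) big_split_ord/= addrC big1 => [|i _]; last first.
  by rewrite ak ?mulr0.
by rewrite add0r !big_ord_recl big_ord0 addr0 expr0 expr1 mul1r.
Qed.

End Extremal.

Lemma slice_derivative_affine (R : realType) (f : quat R -> quat R) (a b : quat R) :
  (forall q, qball 1 q -> f q = a + q * b) -> slice_derivative f 0 = b.
Proof.
move=> fab; apply: cvg_lim => //; apply/cvgrPdist_lt => e e0.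
exists 1 => //= h; rewrite /ball_/= sub0r normrN => h1 h0.
rewrite addr0 !fab /qball/= ?normr0 ?quat_norm_alg//.
rewrite mul0r addr0 [a + _]addrC addrK -scalerAl mul1r scalerA mulVf//.
by rewrite scale1r subrr normr0.
Qed.

Theorem theorem1p7 (R : realType) (f : quat R -> quat R)
    (f_regular : slice_regular f)
    (f_diam : slice_d3 f = d3 (qball 1)) :
  [/\ forall r : R, 0 < r < 1 -> (slice_d3_ball f r <= d3 (qball r))%E,
      `|slice_derivative f 0| <= 1 &
      ((exists r : R, 0 < r < 1 /\ slice_d3_ball f r = d3 (qball r))
       \/ `|slice_derivative f 0| = 1)
      <-> exists a b : quat R, `|b| = 1 /\
            forall q, qball 1 q -> f q = a + q * b].
Proof.
have b1E : `|normalized_coefs f 1%N| = `|slice_derivative f 0|.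
  by rewrite norm_normalized_coefs slice_derivative0.
have B := norm_b1_le1 f_regular f_diam; rewrite b1E in B.
split=> //; first exact: slice_d3_ball_le.
split=> [eqAB|[a [b [b1 fab]]]]; last first.
  by right; rewrite (slice_derivative_affine fab).
have d1 : `|slice_derivative f 0| = 1.
  case: eqAB => // -[r [r01 rE]]; apply/eqP; rewrite eq_le B/= leNgt.
  apply/negP => d1; have := slice_d3_ball_lt f_regular f_diam r01.
  by rewrite b1E rE ltxx => /(_ d1).
exists (coefs f 0), (coefs f 1); rewrite -slice_derivative0//; split=> // q q1.
rewrite slice_derivative0//; apply: (affine_of_norm_b1 f_regular f_diam) => //.
by rewrite b1E.
Qed.
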